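(* Let $A\in\mathbb{R}^{n\times n}$, $B\in\mathbb{R}^{n\times p}$, $C\in\mathbb{R}^{m\times n}$. Assume that the finite cost condition holds for the triple $(A,B,C)$, i.e., for every $\xi\in\mathbb{R}^n$ there exists $u\in L^2((0,+\infty);\mathbb{R}^p)$ such that $$\int_0^\infty\big(\|Cx\|^2+\|u\|^2\big)\,ds<+\infty,\quad\text{where } x'=Ax+Bu\ \text{ and }\ x(0)=\xi.$$ Then there exists an $n\times n$ symmetric matrix $P$ such that, for every $\xi\in\mathbb{R}^n$, $$\langle P\xi,\xi\rangle=\inf_{u\in L^2((0,+\infty);\mathbb{R}^p)}\int_0^\infty\big(\|Cx\|^2+\|u\|^2\big)\,ds,\quad\text{where } x'=Ax+Bu\ \text{ and }\ x(0)=\xi.$$ Given $\xi\in\mathbb{R}^n$, let $\tilde u$ be the optimal solution of this minimization problem and $\tilde x$ the corresponding solution of $x'=Ax+Bu$, $x(0)=\xi$, with $u=\tilde u$. Then $$\tilde u=-B^\top P\tilde x\ \text{ in }[0,+\infty),$$ and $P$ satisfies the algebraic Riccati equation $$A^\top P+PA-PBB^\top P+C^\top C=0.$$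
   Context: $\|\cdot\|$ and $\langle\cdot,\cdot\rangle$ are the Euclidean norm and scalar product. Under the finite cost condition, for each $\xi$ the infinite-horizon minimization problem has a unique minimizer $\tilde u\in L^2((0,+\infty);\mathbb{R}^p)$, called the optimal solution. Identities involving $\tilde u$ are understood almost everywhere. *)

(* Defs.v *)
From HB Require Import structures.
From mathcomp Require Import all_boot all_order all_algebra.
From mathcomp Require Import all_classical all_reals all_analysis.

Set Implicit Arguments.
Unset Strict Implicit.
Unset Printing Implicit Defensive.

Import Order.TTheory GRing.Theory Num.Theory.
Import numFieldNormedType.Exports.

Local Open Scope classical_set_scope.
Local Open Scope ring_scope.

(* The canonical norm `|v| of a matrix is the sup norm, so the Euclidean
   structure of R^n is introduced separately. *)
Definition dotp (R : realType) (n : nat) (v w : 'cV[R]_n) : R :=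
  \sum_(i < n) v i 0 * w i 0.

Definition enorm (R : realType) (n : nat) (v : 'cV[R]_n) : R :=
  Num.sqrt (dotp v v).

(* Elements of L^2((0,+oo); R^p) are handled through representatives. *)
Definition L2_control (R : realType) (p : nat) (u : R -> 'cV[R]_p) : Prop :=
  (forall i : 'I_p, measurable_fun (`]0, +oo[ : set R) (fun t => u t i 0)) /\
  (\int[lebesgue_measure]_(t in `]0%R, +oo[) ((enorm (u t)) ^+ 2)%:E < +oo)%E.

Definition abs_continuous (R : realType) (a b : R) (f : R -> R) : Prop :=
  forall e : R, 0 < e -> exists2 d : R, 0 < d &
    forall (k : nat) (l r : 'I_k -> R),
      (forall i, a <= l i /\ l i <= r i /\ r i <= b) ->
      trivIset setT (fun i => `]l i, r i[%classic) ->
      \sum_(i < k) (r i - l i) < d ->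
      \sum_(i < k) `|f (r i) - f (l i)| < e.

(* Since u is only an L^2 function, x' = A x + B u is understood in the sense
   of Caratheodory: x is locally absolutely continuous on [0,+oo) and the
   equation holds almost everywhere. Only the values of x on [0,+oo) matter. *)
Definition trajectory (R : realType) (n p : nat) (A : 'M[R]_n)
    (B : 'M[R]_(n, p)) (xi : 'cV[R]_n) (u : R -> 'cV[R]_p)
    (x : R -> 'cV[R]_n) : Prop :=
  [/\ x 0 = xi,
      forall (T : R) (i : 'I_n), 0 < T ->
        abs_continuous 0 T (fun t => x t i 0) &
      {ae lebesgue_measure, forall t : R, 0 < t ->
        forall i : 'I_n,
          is_derive t (1 : R) (fun s => x s i 0)
            ((A *m x t + B *m u t) i 0)}].

Definition cost (R : realType) (n p m : nat) (C : 'M[R]_(m, n))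
    (u : R -> 'cV[R]_p) (x : R -> 'cV[R]_n) : \bar R :=
  (\int[lebesgue_measure]_(t in `]0%R, +oo[)
     ((enorm (C *m x t)) ^+ 2 + (enorm (u t)) ^+ 2)%:E)%E.

Definition admissible (R : realType) (n p : nat) (A : 'M[R]_n)
    (B : 'M[R]_(n, p)) (xi : 'cV[R]_n) (u : R -> 'cV[R]_p)
    (x : R -> 'cV[R]_n) : Prop :=
  L2_control u /\ trajectory A B xi u x.

Definition finite_cost_condition (R : realType) (n p m : nat) (A : 'M[R]_n)
    (B : 'M[R]_(n, p)) (C : 'M[R]_(m, n)) : Prop :=
  forall xi : 'cV[R]_n, exists (u : R -> 'cV[R]_p) (x : R -> 'cV[R]_n),
    admissible A B xi u x /\ (cost C u x < +oo)%E.

Definition value (R : realType) (n p m : nat) (A : 'M[R]_n)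
    (B : 'M[R]_(n, p)) (C : 'M[R]_(m, n)) (xi : 'cV[R]_n) : \bar R :=
  ereal_inf [set J | exists (u : R -> 'cV[R]_p) (x : R -> 'cV[R]_n),
                       admissible A B xi u x /\ J = cost C u x].

Definition optimal (R : realType) (n p m : nat) (A : 'M[R]_n)
    (B : 'M[R]_(n, p)) (C : 'M[R]_(m, n)) (xi : 'cV[R]_n)
    (u : R -> 'cV[R]_p) (x : R -> 'cV[R]_n) : Prop :=
  admissible A B xi u x /\
  forall (v : R -> 'cV[R]_p) (y : R -> 'cV[R]_n),
    admissible A B xi v y -> (cost C u x <= cost C v y)%E.

(* Main.v *)
Require Import Defs.
From HB Require Import structures.
From mathcomp Require Import all_boot all_order all_algebra.
From mathcomp Require Import all_classical all_reals all_analysis.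
From mathcomp Require Import measurable_realfun ring lra.

(* Homogeneity and the parallelogram law for the cost pass to the value
   function V, so V(xi) = <P xi, xi> with P symmetric. With S the left-hand
   side of the Riccati equation, completing the square gives along trajectories
     |Cx|^2 + |u|^2 + (d/dt) V(x) = |u + B^T P x|^2 + <S x, x>.
   Dynamic programming with a constant control near time 0 gives <S xi, xi> >= 0.
   For the converse, no optimal trajectory is needed: bounding the cost of a
   nearly optimal trajectory on [0, h] below by a functional that is affine in
   (x, u), and eliminating x and u by the adjoint equation q' = A^T q + C^T C xi,
   q(0) = P xi, one gets 2 <q(h), xi> <= 2 V(xi) + h (|C xi|^2 + |B^T P xi|^2 + o(1)),
   whose derivative at h = 0 is <S xi, xi> <= 0. Hence S = 0. Along an optimal
   trajectory the integral of |Cx|^2 + |u|^2 over [0, t] plus V(x(t)) is constant,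
   so |u + B^T P x|^2 = 0 almost everywhere. *)

Set Implicit Arguments.
Unset Strict Implicit.
Unset Printing Implicit Defensive.

Import Order.TTheory GRing.Theory Num.Theory.
Import numFieldNormedType.Exports.

Local Open Scope classical_set_scope.
Local Open Scope ring_scope.

(** * Quadratic forms *)

Section dotp_theory.
Context {R : realType} {n : nat}.
Implicit Types (v w z : 'cV[R]_n) (c : R).

Lemma dotpE v w : dotp v w = (v^T *m w) 0 0.
Proof. by rewrite mxE; apply: eq_bigr => i _; rewrite mxE. Qed.

Lemma dotpC v w : dotp v w = dotp w v.
Proof. by apply: eq_bigr => i _; rewrite mulrC. Qed.

Lemma dotpDl v w z : dotp (v + w) z = dotp v z + dotp w z.
Proof. by rewrite -big_split; apply: eq_bigr => i _; rewrite mxE mulrDl. Qed.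

Lemma dotpZl c v w : dotp (c *: v) w = c * dotp v w.
Proof. by rewrite mulr_sumr; apply: eq_bigr => i _; rewrite mxE mulrA. Qed.

Lemma dotpNl v w : dotp (- v) w = - dotp v w.
Proof. by rewrite -scaleN1r dotpZl mulN1r. Qed.

Lemma dotpDr v w z : dotp z (v + w) = dotp z v + dotp z w.
Proof. by rewrite dotpC dotpDl !(dotpC z). Qed.

Lemma dotpZr c v w : dotp v (c *: w) = c * dotp v w.
Proof. by rewrite dotpC dotpZl dotpC. Qed.

Lemma dotpNr v w : dotp v (- w) = - dotp v w.
Proof. by rewrite dotpC dotpNl dotpC. Qed.

Lemma dotp0l v : dotp 0 v = 0.
Proof. by rewrite -(scale0r v) dotpZl mul0r. Qed.

Lemma dotp0r v : dotp v 0 = 0. Proof. by rewrite dotpC dotp0l. Qed.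

Lemma dotp_ge0 v : 0 <= dotp v v.
Proof. by apply: sumr_ge0 => i _; rewrite -expr2 sqr_ge0. Qed.

Lemma dotp_eq0 v : dotp v v = 0 -> v = 0.
Proof.
move=> v0; apply/matrixP => i j; rewrite (ord1 j) !mxE.
have /eqP := v0; rewrite psumr_eq0; last by move=> k _; rewrite -expr2 sqr_ge0.
by move=> /allP /(_ i (mem_index_enum _)) /=; rewrite mulf_eq0 orbb => /eqP.
Qed.

Lemma enorm_sqr v : enorm v ^+ 2 = dotp v v.
Proof. by rewrite sqr_sqrtr // dotp_ge0. Qed.

End dotp_theory.

Lemma dotp_mull {R : realType} {n m : nat} (K : 'M[R]_(m, n)) v w :
  dotp (K *m v) w = dotp v (K^T *m w).
Proof. by rewrite !dotpE trmx_mul mulmxA. Qed.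

(** Subtracting [x * f 1] leaves an additive [g] that vanishes on the integers. It has period 1,
    hence is bounded on the whole line, and [g (x *+ n) = g x *+ n] then forces [g x = 0]. *)
Lemma bounded_additive_linear {R : realType} (f : R -> R) (M : R) :
  {morph f : x y / x + y} -> (forall x, `|x| <= 1 -> `|f x| <= M) ->
  forall x, f x = x * f 1.
Proof.
move=> fD fM.
pose g x := f x - x * f 1.
have gD x y : g (x + y) = g x + g y by rewrite /g fD; ring.
have g0 : g 0 = 0 by have := gD 0 0; rewrite addr0; lra.
have g1 : g 1 = 0 by rewrite /g mul1r subrr.
have gN x : g (- x) = - g x by have := gD x (- x); rewrite subrr g0; lra.
have gn n x : g (x *+ n) = g x *+ n.
  by elim: n => [|n IH]; rewrite ?mulr0n// !mulrS gD IH.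
have gz (z : int) : g z%:~R = 0.
  by case: z => n; rewrite ?NegzE -?pmulrn ?nmulrn ?gN gn g1 mul0rn ?oppr0.
pose M' := M + `|f 1|.
have gM x : `|g x| <= M'.
  have -> : x = (Num.floor x)%:~R + (x - (Num.floor x)%:~R) by ring.
  rewrite gD gz add0r; set y := _ - _.
  have y01 : `|y| <= 1.
    have /andP[h1 h2] := floor_itv x.
    by move: h1 h2; rewrite /y ler_norml intrD => ? ?; lra.
  rewrite (le_trans (ler_normB _ _))// lerD ?fM//.
  by rewrite normrM ler_piMl.
move=> x; apply/eqP; rewrite -subr_eq0; apply/eqP.
rewrite -/(g x); apply/eqP; rewrite -normr_le0 leNgt; apply/negP => gx.
have := gM (x *+ (Num.bound (M' / `|g x|))); rewrite gn normrMn -mulr_natr.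
apply/negP; rewrite -ltNge mulrC -ltr_pdivrMr//.
by apply: archi_boundP; rewrite divr_ge0// (le_trans _ (gM 0)).
Qed.

(* The Jordan-von Neumann theorem; nonnegativity replaces the continuity that
   is needed to pass from additivity to homogeneity of the polar form. *)
Lemma parallelogram_quadratic {R : realType} {n : nat} (V : 'cV[R]_n -> R) :
  (forall x, 0 <= V x) -> (forall c x, V (c *: x) = c ^+ 2 * V x) ->
  (forall x y, V (x + y) + V (x - y) = 2 * V x + 2 * V y) ->
  exists P : 'M[R]_n, P^T = P /\ forall x, dotp (P *m x) x = V x.
Proof.
move=> V0 VZ VD.
have Z0 : V 0 = 0 by rewrite -(scale0r 0) VZ expr0n mul0r.
have VN x : V (- x) = V x by rewrite -scaleN1r VZ sqrrN expr1n mul1r.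
pose b x y := (V (x + y) - V (x - y)) / 4.
have bC x y : b x y = b y x.
  by rewrite /b (addrC x y) -(VN (x - y)) opprB.
(* This is the difference of the parallelogram laws at [x + y, z] and [x - y, z]. *)
have bJ x y z : b (x + z) y + b (x - z) y = 2 * b x y.
  rewrite /b; have := VD (x + y) z; have := VD (x - y) z.
  have -> : x + z + y = x + y + z by rewrite addrAC.
  have -> : x + z - y = x - y + z by rewrite addrAC.
  have -> : x - z + y = x + y - z by rewrite addrAC.
  have -> : x - z - y = x - y - z by rewrite addrAC.
  lra.
have b0 y : b 0 y = 0 by rewrite /b add0r sub0r VN subrr mul0r.
(* With [X] and [Z] the half-sum and half-difference, [bJ] turns both sides into [2 * b X y]. *)
have bD x y z : b (x + z) y = b x y + b z y.
  pose X := 2^-1 *: (x + z); pose Z := 2^-1 *: (x - z).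
  have e1 : X + Z = x by rewrite /X /Z; apply/matrixP => i j; rewrite !mxE; field.
  have e2 : X - Z = z by rewrite /X /Z; apply/matrixP => i j; rewrite !mxE; field.
  have e3 : X + X = x + z by rewrite /X /Z; apply/matrixP => i j; rewrite !mxE; field.
  have := bJ X y Z; have := bJ X y X.
  by rewrite subrr b0 addr0 e1 e2 e3 => -> ->.
(* For [t] in [-1, 1], nonnegativity of [V (t *: x + y)] and [V (t *: x - y)] bounds their
   difference by their sum, hence [b (t *: x) y] by half of [V x + V y]. *)
have bZ c x y : b (c *: x) y = c * b x y.
  have := @bounded_additive_linear _ (fun t => b (t *: x) y) ((V x + V y) / 2).
  move=> /(_ _ _ c) ->; first by rewrite scale1r.
    by move=> s t; rewrite scalerDl bD.
  move=> t; rewrite ler_norml => /andP[t1 t2].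
  have := V0 (t *: x + y); have := V0 (t *: x - y).
  have := VD (t *: x) y; rewrite VZ /b => h ? ?.
  have := V0 x => Vx.
  have : t ^+ 2 * V x <= 1 * V x by rewrite ler_wpM2r//; nra.
  by rewrite ler_norml; lra.
pose P : 'M[R]_n := \matrix_(i, j) b (delta_mx i 0) (delta_mx j 0).
exists P; split; first by apply/matrixP => i j; rewrite !mxE bC.
have bsum (I : Type) (r : seq I) (F : I -> 'cV[R]_n) y :
    b (\sum_(i <- r) F i) y = \sum_(i <- r) b (F i) y.
  by elim/big_rec2 : _ => [|i u v _ <-]; rewrite ?b0 ?bD.
move=> x.
have decomp : x = \sum_i x i 0 *: delta_mx i 0.
  by rewrite [LHS]matrix_sum_delta; apply: eq_bigr => i _; rewrite big_ord1.
have -> : V x = b x x.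
  by rewrite /b subrr Z0 -mulr2n -scaler_nat VZ; field.
rewrite [in RHS]decomp bsum /dotp; apply: eq_bigr => i _.
rewrite bZ [RHS]mulrC; congr (_ * _).
rewrite bC [in RHS]decomp bsum mxE; apply: eq_bigr => j _.
by rewrite bZ bC [RHS]mulrC [P _ _]mxE -decomp.
Qed.

(** * Affine differential equations *)

Section entire_series.
Context {R : realType}.
Variables (c : nat -> R) (M r : R).
Hypothesis cM : forall k, `|c k| <= M * r ^+ k.
Hypothesis r0 : 0 <= r.

(** Comparison with [M] times an exponential series. *)
Lemma is_cvg_pseries_fact x : cvgn (pseries (fun k => c k / k`!%:R) x).
Proof.
have M0 : 0 <= M by have := cM 0; rewrite expr0 mulr1; exact: le_trans.
apply: normed_cvg.
apply: (@series_le_cvg _ _ (fun k => M * exp_coeff (r * `|x|) k)) => [k|k|k|].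
- exact: normr_ge0.
- by rewrite mulr_ge0// exp_coeff_ge0 ?mulr_ge0.
- rewrite /exp_coeff /= !normrM normfV normr_nat exprMn normrX.
  rewrite mulrAC mulrA mulrA ler_wpM2r// ler_wpM2r// ?exprn_ge0//.
- exact/is_cvg_seriesZ/is_cvg_series_exp_coeff.
Qed.

End entire_series.

Section entire_series_derivative.
Context {R : realType}.
Variables (c : nat -> R) (M r : R).
Hypothesis cM : forall k, `|c k| <= M * r ^+ k.
Hypothesis r0 : 0 <= r.

(** Termwise differentiation shifts [c] by one index, which preserves the geometric bound up to a
    factor [r]. Hence the series and its first two derived series converge at a point beyond [x]. *)
Lemma is_derive_pseries_fact x :
  is_derive x (1 : R) (fun x => limn (pseries (fun k => c k / k`!%:R) x))
    (limn (pseries (fun k => c k.+1 / k`!%:R) x)).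
Proof.
have dE (d : nat -> R) : pseries_diffs (fun k => d k / k`!%:R) =
    (fun k => d k.+1 / k`!%:R).
  apply/funext => k; rewrite /pseries_diffs factS natrM invfM.
  by rewrite mulrCA mulVKf.
have cS (d : nat -> R) N : (forall k, `|d k| <= N * r ^+ k) ->
    forall k, `|d k.+1| <= (N * r) * r ^+ k.
  by move=> dN k; rewrite -mulrA -exprS.
rewrite -dE; apply: (@pseries_snd_diffs _ _ (`|x| + 1)).
- exact: is_cvg_pseries_fact cM r0 _.
- by rewrite dE; apply: is_cvg_pseries_fact (cS _ _ cM) r0 _.
- by rewrite !dE; apply: is_cvg_pseries_fact (cS _ _ (cS _ _ cM)) r0 _.
- by rewrite [ltRHS]ger0_norm ?addr_ge0// ltrDl.
Qed.

End entire_series_derivative.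

(** The solution is its Taylor series at 0: the equation dictates all derivatives there, and they
    grow at most geometrically. *)
Lemma affine_ode_solution {R : realType} {n : nat} (K : 'M[R]_n)
    (b q0 : 'cV[R]_n) :
  exists q : R -> 'cV[R]_n, q 0 = q0 /\
    forall t i, is_derive t (1 : R) (fun s => q s i 0) ((K *m q t + b) i 0).
Proof.
(* [a k] is the derivative of order [k] at 0; the constant [b] enters at order 1 only. *)
pose a k := if k is k'.+1 then iter k' (mulmx K) (K *m q0 + b) else q0.
have aS k : a k.+1 = K *m a k + (if k == 0%N then b else 0).
  by case: k => [|k] //=; rewrite addr0.
pose N (v : 'cV[R]_n) : R := \sum_i `|v i 0|.
pose rho : R := \sum_i \sum_j `|K i j|.
have NK v : N (K *m v) <= rho * N v.
  rewrite /N /rho mulr_suml; apply: ler_sum => i _.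
  rewrite mxE (le_trans (ler_norm_sum _ _ _))// mulr_suml; apply: ler_sum => j _.
  rewrite normrM ler_wpM2l// (bigD1 j)//= lerDl; exact: sumr_ge0.
have N0 v : 0 <= N v by apply: sumr_ge0.
have rho0 : 0 <= rho by apply: sumr_ge0 => i _; apply: sumr_ge0.
(* The base [1 + rho] is at least 1, so the bound survives the index shift between [a] and the
   iterates. *)
have iterN k v : N (iter k (mulmx K) v) <= (1 + rho) ^+ k * N v.
  elim: k => [|k IH] /=; first by rewrite expr0 mul1r.
  rewrite (le_trans (NK _))// exprS -mulrA ler_pM//.
  by rewrite lerDr.
pose M : R := N q0 + N (K *m q0 + b).
have aM i k : `|a k i 0| <= M * (1 + rho) ^+ k.
  have Ni (v : 'cV[R]_n) : `|v i 0| <= N v.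
    by rewrite /N (bigD1 i)//= lerDl; exact: sumr_ge0.
  apply: (le_trans (Ni _)); case: k => [|k] /=.
    by rewrite expr0 mulr1 lerDl.
  rewrite (le_trans (iterN _ _))// mulrC ler_pM ?exprn_ge0 ?addr_ge0//.
    by rewrite lerDr.
  by rewrite ler_weXn2l// lerDl.
have r0 : 0 <= 1 + rho by rewrite addr_ge0.
have a0 : a 0%N = q0 by [].
clearbody a.
pose c i k := a k i 0 / k`!%:R.
exists (fun t => \col_i limn (pseries (c i) t)); split.
  apply/matrixP => i j; rewrite (ord1 j) mxE; apply: lim_near_cst => //.
  exists 1%N => // m /= m0; rewrite /pseries /series /= -(prednK m0).
  rewrite big_nat_recl// /c /= a0 fact0 divr1 mulr1 big1 ?addr0// => k _.
  by rewrite expr0n mulr0.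
move=> t i.
have -> : (fun s => (\col_i limn (pseries (c i) s)) i 0) =
    (fun s => limn (pseries (c i) s)) by apply/funext => s; rewrite mxE.
apply: is_derive_eq (is_derive_pseries_fact (aM i) r0 t) _.
apply/cvg_lim => //; rewrite mxE; rewrite mxE.
have -> : pseries (fun k => a k.+1 i 0 / k`!%:R) t =
    (fun m => \sum_j K i j * pseries (c j) t m +
      pseries (fun k => (if k == 0%N then b else 0) i 0 / k`!%:R) t m).
  apply/funext => m.
  under eq_bigr do rewrite mulr_sumr.
  rewrite exchange_big -big_split; apply: eq_bigr => k _.
  rewrite /= aS mxE mxE !mulrDl; congr (_ + _).
  by rewrite !mulr_suml; apply: eq_bigr => j _; rewrite /c !mulrA.
apply: cvgD.
  apply: cvg_big => [|j _]; first exact: add_continuous.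
  rewrite mxE; apply: cvgMl_tmp; exact: is_cvg_pseries_fact (aM j) r0 _.
apply: cvg_near_cst; exists 1%N => // m /= m0; rewrite /pseries /series /= -(prednK m0).
rewrite big_nat_recl//= fact0 divr1 mulr1 big1 ?addr0// => k _.
by rewrite mxE mul0r mul0r.
Qed.

(** * Absolutely continuous functions *)

(** The supremum of the points where [S] holds is approached from the left by such points. The step
    carries [S] to the supremum and, were it below [b], beyond it. *)
Lemma continuous_induction {R : realType} (a b : R) (S : R -> Prop) :
  a <= b -> S a ->
  (forall s, a <= s <= b -> exists2 g, 0 < g & forall y z,
    a <= y -> z <= b -> s - g < y <= s -> s <= z < s + g -> S y -> S z) ->
  S b.
Proof.
move=> ab Sa step.
pose X := [set s | a <= s <= b /\ S s].
have Xa : X a by rewrite /X /= lexx ab.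
have hX : has_sup X by split; [exists a|exists b => s /= [/andP[]]].
have as_ : a <= sup X by apply: ub_le_sup => //; case: hX.
have sb : sup X <= b by apply: ge_sup => [|s /= [/andP[]]//]; exists a.
have [|g g0 gS] := step (sup X); first by rewrite as_.
have [y [/andP[ay yb] Sy] gy] := sup_adherent g0 hX.
have ys : y <= sup X by apply: ub_le_sup; [case: hX|rewrite /X /= ay yb].
have step' z : sup X <= z < sup X + g -> z <= b -> S z.
  by move=> sz zb; apply: (gS y) => //; rewrite gy.
have [bs|sb'] := leP b (sup X).
  by apply: step' => //; rewrite sb/= (le_lt_trans bs)// ltrDl.
pose z := Num.min b (sup X + g / 2).
have sz : sup X < z by rewrite lt_min sb' ltrDl divr_gt0.
have zX : X z.
  split; first by rewrite ge_min lexx (le_trans as_ (ltW sz)).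
  apply: step'; last by rewrite ge_min lexx.
  by rewrite (ltW sz)/= gt_min ltrD2l gtr_pMr// invf_lt1 ?ltr1n ?orbT.
suff : z <= sup X by rewrite leNgt sz.
by apply: ub_le_sup => //; case: hX.
Qed.

Lemma is_derive_littleo {R : realType} (f : R -> R) (t d e : R) :
  is_derive t (1 : R) f d -> 0 < e ->
  exists2 g, 0 < g & forall z, `|z - t| < g ->
    `|f z - f t - d * (z - t)| <= e * `|z - t|.
Proof.
move=> [df <-] e0.
have /cvgrPdist_le /(_ _ e0) /nbhs_ballP[g /= g0 gP] := df.
exists g => // z zt.
have [->|zt0] := eqVneq z t; first by rewrite !subrr mulr0 subr0 normr0 mulr0.
have zt1 : z - t != 0 by rewrite subr_eq0.
have := gP (z - t); rewrite /ball /= sub0r normrN => /(_ zt zt1).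
rewrite [_ *: 1]mulr1 subrK.
set D := 'D_1 f t; rewrite -(ler_pM2r (_ : 0 < `|z - t|)) ?normr_gt0//.
by rewrite -normrM mulrBl [_^-1 *: _]mulrC mulfVK// distrC.
Qed.

(* Cover the exceptional null set by an open set U of small measure. Creeping
   from a to b, the loss of G + phi is at most e * (b - a) outside U, by
   differentiability, and is controlled in U by the absolute continuity of phi
   alone, since G does not decrease. *)
Lemma le_of_ae_derive_ge0 {R : realType} (a b : R) (G phi : R -> R) :
  a <= b -> (forall s t, a <= s -> s <= t -> t <= b -> G s <= G t) ->
  abs_continuous a b phi ->
  {ae lebesgue_measure, forall t, a < t < b ->
     exists2 d, 0 <= d & is_derive t (1 : R) (fun s => G s + phi s) d} ->
  G a + phi a <= G b + phi b.
Proof.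
move=> ab Gnd ACphi [N [mN N0 HN]].
apply/ler_addgt0Pr => _/posnumP[e0].
(* The loss will be at most [e * (b - a)] outside [U] and [e] inside, [e0] altogether. *)
pose e := e0%:num / (1 + (b - a)).
have ba : 0 < 1 + (b - a) by rewrite ltr_pwDl// subr_ge0.
have e_gt0 : 0 < e by rewrite divr_gt0.
have [d d0 dP] := ACphi _ e_gt0.
(* The endpoints join the null set because the derivative is given in the open interval only. *)
pose N' := N `|` ([set a] `|` [set b]).
have mN' : measurable N' by do 2?apply: measurableU => //; exact: measurable_set1.
have N'0 : lebesgue_measure N' = 0%E.
  do 2?apply: null_set_setU => //; try exact: measurable_set1.
  - by apply: measurableU; exact: measurable_set1.
  - exact: lebesgue_measure_set1.
  - exact: lebesgue_measure_set1.
have N'fin : (lebesgue_measure N' < +oo)%E by rewrite N'0.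
have [U [oU NU Ud]] := lebesgue_regularity_outer mN' N'fin d0.
have mU : measurable U by exact: open_measurable.
have muU : (lebesgue_measure U < d%:E)%E.
  have DI := measureDI (@lebesgue_measure R) mU mN'.
  rewrite DI [X in (_ + X)%E](_ : _ = 0%E) ?adde0//.
  by apply: (@subset_measure0 _ _ _ (@lebesgue_measure R) _ N') => //; exact: measurableI.
pose f s := G s + phi s.
(* The ledger at [s]: the intervals of [U] crossed so far, with the loss of [f] charged to them and
   to the slope [e]. *)
pose S s := exists (k : nat) (l r : 'I_k -> R),
  [/\ (forall i, a <= l i /\ l i <= r i /\ r i <= s),
      trivIset setT (fun i => `]l i, r i[%classic),
      (forall i, `]l i, r i[ `<=` U) &
      f a <= f s + e * (s - a) + \sum_(i < k) `|phi (r i) - phi (l i)|].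
have Sb : S b.
  apply: (@continuous_induction _ a) => //.
    exists 0%N, (fun=> 0), (fun=> 0); split; try by case.
    by rewrite big_ord0 subrr mulr0 !addr0.
  move=> s /andP[as_ sb].
  (* At an exceptional point the interval from [y] to [z] lies in [U] and is appended to the list.
     Since [G y <= G z], the loss of [f] on it is at most the variation of [phi]. *)
  have [Ns|Ns] := pselect (N' s).
    have /open_nbhs_nbhs : open_nbhs s U by split => //; exact: NU.
    move=> /nbhs_ballP[g /= g0 gU].
    exists g => // y z ay zb /andP[gy ys] /andP[sz zg].
    move=> [k [l [r [lr dis lrU fa]]]].
    have yz := le_trans ys sz.
    pose l' i := oapp l y (unlift ord_max i).
    pose r' i := oapp r z (unlift ord_max i).
    exists k.+1, l', r'; split.
    - move=> i; rewrite /l' /r'; case: unliftP => [j|] _ /=; last by split.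
      have [? [? rj]] := lr j; do 2!split => //; exact: le_trans yz.
    - move=> i j _ _; rewrite /l' /r'.
      case: (unliftP ord_max i) => [i'|] ->; case: (unliftP ord_max j) => [j'|] -> //=.
      + by move=> /(dis i' j' I I) ->.
      + move=> [w [/=]]; rewrite !in_itv/= => /andP[_ w1] /andP[w2 _].
        by have [_ [_ ri]] := lr i'; move: (lt_trans w2 w1); rewrite ltNge ri.
      + move=> [w [/=]]; rewrite !in_itv/= => /andP[w2 _] /andP[_ w1].
        by have [_ [_ ri]] := lr j'; move: (lt_trans w2 w1); rewrite ltNge ri.
    - move=> i; rewrite /l' /r'; case: unliftP => [j|] _ /=; first exact: lrU.
      move=> w /=; rewrite in_itv/= => /andP[yw wz]; apply: gU.
      by rewrite /ball /= ltr_norml; lra.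
    - rewrite big_ord_recr/= /l' /r' unlift_none/=.
      rewrite (eq_bigr (fun i => `|phi (r i) - phi (l i)|)); last first.
        move=> i _; have -> : widen_ord (leqnSn k) i = lift ord_max i.
          by apply/val_inj; rewrite /= /bump leqNgt ltn_ord.
        by rewrite liftK.
      have := Gnd y z ay yz zb.
      have : phi y - phi z <= `|phi z - phi y| by rewrite distrC ler_norm.
      have : e * y <= e * z by rewrite ler_wpM2l// ltW.
      by move: fa; rewrite /f; set X := \sum_(_ < _) _; lra.
  (* Elsewhere the first-order estimates at [y] and [z], on either side of [s], give
     [f y <= f z + e * (z - y)]; the list is unchanged. *)
  have [d' d'0 df] : exists2 d, 0 <= d & is_derive s (1 : R) f d.
    apply: contrapT => nd; apply: Ns; rewrite /N'.
    have [->|sa] := eqVneq s a; first by right; left.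
    have [->|sb'] := eqVneq s b; first by right; right.
    left; apply: HN => /= H; apply: nd; apply: H.
    by rewrite !lt_neqAle as_ sb sb' eq_sym sa.
  have [g g0 gP] := is_derive_littleo df e_gt0.
  exists g => // y z ay zb /andP[gy ys] /andP[sz zg].
  have yz := le_trans ys sz.
  move=> [k [l [r [lr dis lrU fa]]]]; exists k, l, r; split => //.
    by move=> i; have [? [? ri]] := lr i; do 2!split => //; exact: le_trans yz.
  rewrite (le_trans fa)// lerD2r.
  have yg : `|y - s| < g by rewrite ltr_norml; lra.
  have zg' : `|z - s| < g by rewrite ltr_norml; lra.
  have := gP y yg; have := gP z zg'.
  have ys' : y - s <= 0 by rewrite subr_le0.
  have sz' : 0 <= z - s by rewrite subr_ge0.
  have := mulr_ge0 d'0 sz'; have : 0 <= d' * (s - y) by rewrite mulr_ge0// subr_ge0.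
  rewrite !ler_norml (ler0_norm ys') (ger0_norm sz').
  by move=> ? ? /andP[? ?] /andP[? ?]; lra.
have [k [l [r [lr dis lrU fa]]]] := Sb.
rewrite -/(f a) -/(f b) (le_trans fa)//.
(* The intervals are disjoint and lie in [U], so their total length is at most its measure. *)
have sd : \sum_(i < k) (r i - l i) < d.
  rewrite -lte_fin (le_lt_trans _ muU)// -sumEFin.
  rewrite (eq_bigr (fun i => lebesgue_measure (`]l i, r i[%classic : set R))); last first.
    move=> i _; have [_ [lri _]] := lr i.
    rewrite lebesgue_measure_itv/= lte_fin EFinB.
    by case: ltgtP lri => // ->; rewrite subee.
  rewrite fsbig_seq ?index_enum_uniq//.
  have -> : [set` index_enum 'I_k] = setT.
    by apply/seteqP; split => // i _ /=; rewrite mem_index_enum.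
  have fink : finite_set [set: 'I_k] by exact: finite_finset.
  rewrite -measure_fin_bigcup//.
  apply: le_measure; rewrite ?inE//.
    by apply: fin_bigcup_measurable.
  exact: bigcup_sub.
have := dP k l r lr dis sd => h.
have ee : e0%:num = e * (1 + (b - a)) by rewrite /e divfK// gt_eqF.
by rewrite ee; lra.
Qed.

Section abs_continuous_theory.
Context {R : realType}.
Implicit Types (a b : R) (f g h : R -> R).

(** A single domination principle, from which Lipschitz functions, sums, multiples and products
    follow. *)
Lemma abs_continuous_dom a b f g h (K : R) : 0 <= K ->
  (forall s t, a <= s -> s <= t -> t <= b ->
    `|f t - f s| <= K * (`|g t - g s| + `|h t - h s|)) ->
  abs_continuous a b g -> abs_continuous a b h -> abs_continuous a b f.
Proof.
move=> K0 fgh ACg ACh e e0.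
pose e' := e / (2 * (K + 1)).
have K1 : 0 < 2 * (K + 1) by rewrite mulr_gt0// ltr_wpDl.
have e'0 : 0 < e' by rewrite divr_gt0.
have [d1 d10 gP] := ACg _ e'0; have [d2 d20 hP] := ACh _ e'0.
exists (Num.min d1 d2); first by rewrite lt_min d10.
move=> k l r lr dis; rewrite lt_min => /andP[s1 s2].
have := gP k l r lr dis s1; have := hP k l r lr dis s2.
set Sg := \sum_(i < k) `|g _ - _|; set Sh := \sum_(i < k) `|h _ - _| => hS gS.
have : \sum_(i < k) `|f (r i) - f (l i)| <= K * (Sg + Sh).
  rewrite -big_split mulr_sumr; apply: ler_sum => i _.
  by have [? [? ?]] := lr i; exact: fgh.
move=> /le_lt_trans; apply.
have ee : e = e' * (2 * (K + 1)) by rewrite /e' divfK// gt_eqF.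
have : K * (Sg + Sh) <= K * (e' + e') by rewrite ler_wpM2l// lerD// ltW.
by rewrite ee; lra.
Qed.

Lemma abs_continuous_id a b : abs_continuous a b (fun t => t).
Proof.
move=> e e0; exists e => // k l r lr _; apply: le_lt_trans.
by apply: ler_sum => i _; rewrite ger0_norm// subr_ge0; case: (lr i) => _ [].
Qed.

Lemma abs_continuous_lipschitz a b f (K : R) : 0 <= K ->
  (forall s t, a <= s -> s <= t -> t <= b -> `|f t - f s| <= K * (t - s)) ->
  abs_continuous a b f.
Proof.
move=> K0 fK.
apply: (abs_continuous_dom K0 _ (@abs_continuous_id a b) (@abs_continuous_id a b)).
move=> s t as_ st tb; apply: (le_trans (fK _ _ as_ st tb)).
by rewrite ler_wpM2l// [X in _ <= X + _]ger0_norm ?subr_ge0// lerDl.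
Qed.

Lemma abs_continuous_cst a b (c : R) : abs_continuous a b (fun=> c).
Proof.
apply: (@abs_continuous_lipschitz _ _ _ 0) => // s t _ _ _.
by rewrite subrr normr0 mul0r.
Qed.

Lemma abs_continuousD a b f g : abs_continuous a b f -> abs_continuous a b g ->
  abs_continuous a b (fun t => f t + g t).
Proof.
apply: abs_continuous_dom (ler01) _ => s t _ _ _.
by rewrite mul1r opprD addrACA ler_normD.
Qed.

Lemma abs_continuousZ a b (c : R) f : abs_continuous a b f ->
  abs_continuous a b (fun t => c * f t).
Proof.
move=> ACf; apply: (abs_continuous_dom (normr_ge0 c) _ ACf ACf) => s t _ _ _.
by rewrite -mulrBr normrM ler_wpM2l// lerDl.
Qed.

Lemma abs_continuous_sum a b (I : Type) (r : seq I) (F : I -> R -> R) :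
  (forall i, abs_continuous a b (F i)) ->
  abs_continuous a b (fun t => \sum_(i <- r) F i t).
Proof.
move=> ACF; elim: r => [|i r IH].
  under eq_fun do rewrite big_nil; exact: abs_continuous_cst.
by under eq_fun do rewrite big_cons; exact: (abs_continuousD (ACF i) IH).
Qed.

Lemma abs_continuous_unif a b f (e : R) : abs_continuous a b f -> 0 < e ->
  exists2 d, 0 < d & forall s t, a <= s -> s <= t -> t <= b -> t - s < d ->
    `|f t - f s| < e.
Proof.
move=> ACf e0; have [d d0 dP] := ACf _ e0; exists d => // s t as_ st tb std.
have := dP 1%N (fun=> s) (fun=> t); rewrite !big_ord1; apply => //.
by move=> i j _ _ _; rewrite !ord1.
Qed.

(** By uniform continuity, each step of the continuous induction raises the bound by 1. *)
Lemma abs_continuous_bounded a b f : a <= b -> abs_continuous a b f ->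
  exists2 M, 0 <= M & forall t, a <= t -> t <= b -> `|f t| <= M.
Proof.
move=> ab ACf; have [d d0 dP] := abs_continuous_unif ACf ltr01.
apply: (@continuous_induction _ a b (fun s => exists2 M, 0 <= M &
  forall t, a <= t -> t <= s -> `|f t| <= M)) => //.
  by exists `|f a| => // t at_ ta; have -> : t = a by apply/le_anti/andP.
move=> s /andP[as_ sb]; exists (d / 2); first by rewrite divr_gt0.
move=> y z ay zb /andP[gy ys] /andP[sz zg] [M M0 fM].
exists (M + 1); first by rewrite addr_ge0.
move=> t at_ tz; have [ty|yt] := leP t y.
  by rewrite (le_trans (fM _ at_ ty))// lerDl.
have -> : f t = (f t - f y) + f y by rewrite subrK.
rewrite (le_trans (ler_normD _ _))// addrC lerD ?fM//.
by apply/ltW/dP => //; [exact: ltW|exact: le_trans zb|lra].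
Qed.

Lemma abs_continuousM a b f g : a <= b ->
  abs_continuous a b f -> abs_continuous a b g ->
  abs_continuous a b (fun t => f t * g t).
Proof.
move=> ab ACf ACg.
have [M M0 fM] := abs_continuous_bounded ab ACf.
have [N N0 gN] := abs_continuous_bounded ab ACg.
apply: (abs_continuous_dom (addr_ge0 M0 N0) _ ACf ACg) => s t as_ st tb.
have -> : f t * g t - f s * g s = (f t - f s) * g t + f s * (g t - g s) by ring.
rewrite (le_trans (ler_normD _ _))// !normrM.
have := gN t (le_trans as_ st) tb; have := fM s as_ (le_trans st tb).
move: (normr_ge0 (f t - f s)) (normr_ge0 (g t - g s)).
by set x := `|_ - _|; set y := `|_ - _|; nra.
Qed.

(** A nondecreasing change of time with Lipschitz constant 1 sends disjoint intervals to disjoint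
    intervals that are no longer. It serves for shifts and for truncations of time. *)
Lemma abs_continuous_comp a b a' b' f (w : R -> R) :
  abs_continuous a' b' f ->
  (forall s t, a <= s -> s <= t -> t <= b -> 0 <= w t - w s <= t - s) ->
  (forall t, a <= t -> t <= b -> a' <= w t <= b') ->
  abs_continuous a b (fun t => f (w t)).
Proof.
move=> ACf wlip wab e e0; have [d d0 dP] := ACf _ e0.
exists d => // k l r lr dis sd.
have wmono s t : a <= s -> s <= t -> t <= b -> w s <= w t.
  by move=> as_ st tb; have /andP[+ _] := wlip _ _ as_ st tb; rewrite subr_ge0.
apply: (dP k (fun i => w (l i)) (fun i => w (r i))).
- move=> i; have [al [li rb]] := lr i; split.
    by have /andP[] := wab _ al (le_trans li rb).
  split; first exact: wmono.
  by have /andP[] := wab _ (le_trans al li) rb.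
- move=> i j _ _ [z [/=]]; rewrite !in_itv/= => /andP[zi iz] /andP[zj jz].
  apply: dis => //.
  have [al [li rb]] := lr i; have [al' [li' rb']] := lr j.
  have rl' : l j < r i.
    rewrite ltNge; apply/negP => H.
    have := wmono _ _ (le_trans al li) H (le_trans li' rb').
    by rewrite leNgt (lt_trans zj iz).
  have rl : l i < r j.
    rewrite ltNge; apply/negP => H.
    have := wmono _ _ (le_trans al' li') H (le_trans li rb).
    by rewrite leNgt (lt_trans zi jz).
  have lri : l i < r i.
    by rewrite lt_neqAle li andbT; apply/eqP => H; move: (lt_trans zi iz); rewrite H ltxx.
  have lrj : l j < r j.
    by rewrite lt_neqAle li' andbT; apply/eqP => H; move: (lt_trans zj jz); rewrite H ltxx.
  (* If the images meet, the original intervals overlap, and the midpoint of the overlap is a common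
     point. *)
  have mM : Num.max (l i) (l j) < Num.min (r i) (r j).
    by rewrite lt_min !gt_max lri rl' rl lrj.
  have [+ +] := midf_lt mM; rewrite lt_min gt_max => /andP[? ?] /andP[? ?].
  exists ((Num.max (l i) (l j) + Num.min (r i) (r j)) / 2).
  by split => /=; rewrite in_itv/=; apply/andP.
- apply: le_lt_trans sd; apply: ler_sum => i _.
  by have [al [li rb]] := lr i; have /andP[] := wlip _ _ al li rb.
Qed.

Lemma abs_continuous_continuous a b f t : abs_continuous a b f -> a < t < b ->
  {for t, continuous f}.
Proof.
move=> ACf /andP[at_ tb]; apply/cvgrPdist_lt => e e0.
have [d d0 dP] := abs_continuous_unif ACf e0.
near=> s.
have as_ : a < s by near: s; exact: lt_nbhsr.
have sb : s < b by near: s; exact: lt_nbhsl.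
have : `|t - s| < d by near: s; exact: cvgr_dist_lt.
have [st|/ltW ts] := leP s t; [rewrite ger0_norm ?subr_ge0// => std|].
  by apply: dP => //; exact: ltW.
rewrite ler0_norm ?subr_le0// opprB distrC => std.
by apply: dP => //; exact: ltW.
Unshelve. all: by end_near. Qed.

Lemma abs_continuous_derivable a b f (f' : R -> R) : a <= b ->
  (forall t, is_derive t (1 : R) f (f' t)) -> continuous f' ->
  abs_continuous a b f.
Proof.
move=> ab df cf'.
have [c _ cM] : exists2 c, c \in `[a, b] & forall t, t \in `[a, b] -> `|f' t| <= `|f' c|.
  apply: EVT_max => //; apply: continuous_subspaceT => t.
  exact: continuous_comp (cf' t) (@norm_continuous _ _ _).
apply: (@abs_continuous_lipschitz _ _ _ `|f' c|) => // s t as_ st tb.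
have [|z zst ->] := @MVT_segment _ f f' _ _ st (fun x _ => df x).
  apply: derivable_within_continuous => x _; exact: (@ex_derive _ _ _ _ _ _ _ (df x)).
rewrite normrM [X in _ * X]ger0_norm ?subr_ge0// ler_wpM2r ?subr_ge0// cM//.
by move: zst; rewrite !in_itv/= => /andP[? ?]; rewrite (le_trans as_)// (le_trans _ tb).
Qed.

End abs_continuous_theory.

(** * Translation and gluing on the half-line *)

Section translation.
Context {R : realType}.
Local Notation mu := (@lebesgue_measure R).

(** Both measures agree on half-open intervals, which determine Lebesgue measure. *)
Lemma lebesgue_measure_translation (h : R) (A : set R) : measurable A ->
  pushforward mu ((fun t => t + h) : R -> measurableTypeR R) A = mu A.
Proof.
have mh : measurable_fun setT ((fun t => t + h) : R -> measurableTypeR R).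
  exact: measurable_funD.
move=> mA; apply/esym/lebesgue_measure_unique => //= _ [[a b]] _ <-.
rewrite /pushforward/=.
have -> : (fun t => t + h) @^-1` `]a, b] = `]a - h, b - h]%classic.
  by apply/seteqP; split => t /=; rewrite !in_itv/= ltrBlDr lerBrDr.
by rewrite !lebesgue_measure_itv/= !lte_fin ltrD2r -!EFinB opprB addrA subrK.
Qed.

Lemma ge0_integral_translation (h a : R) (f : R -> \bar R) :
  measurable_fun `]a, +oo[ f -> (forall t : R, a < t -> (0 <= f t)%E) ->
  (\int[mu]_(t in `]a, +oo[) f t = \int[mu]_(t in `](a - h)%R, +oo[) f (t + h)%R)%E.
Proof.
move=> mf f0.
have -> : `](a - h)%R, +oo[%classic =
    ((fun t => t + h) : R -> measurableTypeR R) @^-1` `]a, +oo[.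
  by apply/seteqP; split => t /=; rewrite !in_itv/= !andbT ltrBlDr.
have mh : measurable_fun setT ((fun t => t + h) : measurableTypeR R -> measurableTypeR R).
  exact: measurable_funD.
rewrite -[RHS](@ge0_integral_pushforward _ _ (measurableTypeR R)
  (measurableTypeR R) R _ mh mu _ f)//; last first.
  by move=> t; rewrite inE/= in_itv/= andbT => /f0.
by apply: eq_measure_integral => //= A mA _; exact/esym/lebesgue_measure_translation.
Qed.

Lemma ae_translation (h : R) (P : R -> Prop) :
  {ae mu, forall t, P t} -> {ae mu, forall t, P (t + h)}.
Proof.
move=> [N [mN N0 NP]].
exists ((fun t => t + h) @^-1` N); split.
- rewrite -[X in measurable X]setTI.
  by have := measurable_funD (@measurable_id _ R setT) (@measurable_cst _ _ _ R setT h); exact.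
- by have := lebesgue_measure_translation h mN; rewrite /pushforward N0.
- by move=> t /= Pt; exact: NP.
Qed.

(** Allows the gluing time, or time 0, to be discarded. *)
Lemma ae_neq (h : R) : {ae mu, forall t, t != h}.
Proof.
exists [set h]; split; [exact: measurable_set1|exact: lebesgue_measure_set1|].
by move=> t /= /negP; rewrite negbK => /eqP.
Qed.

End translation.

(** Concatenation for dynamic programming: [g] has its own clock, started at time [h]. *)
Definition glue_at {R : realType} {T : Type} (h : R) (f g : R -> T) (t : R) : T :=
  if t <= h then f t else g (t - h).

Section glue_integral.
Context {R : realType}.
Local Notation mu := (@lebesgue_measure R).
Variable h : R.
Hypothesis h0 : 0 < h.

Lemma setU_itv_pos : `]0, h] `|` `]h, +oo[ = `]0, +oo[%classic :> set R.
Proof.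
apply/seteqP; split => t /=; rewrite !in_itv/= !andbT.
  by move=> [/andP[]//|]; exact: lt_trans.
by move=> t0; rewrite t0/=; case: leP => ?; [left|right].
Qed.

Lemma disj_itv_pos : [disjoint (`]0, h]%classic : set R) & (`]h, +oo[%classic : set R)].
Proof.
apply/eqP/seteqP; split => t //= []; rewrite !in_itv/= andbT => /andP[_].
by case: leP.
Qed.

Lemma ge0_integral_split (f : R -> \bar R) : measurable_fun (`]0, +oo[ : set R) f ->
  (forall t : R, 0 < t -> (0 <= f t)%E) ->
  (\int[mu]_(t in `]0%R, +oo[) f t = \int[mu]_(t in `]0%R, h]) f t +
    \int[mu]_(t in `]0%R, +oo[) f (t + h)%R)%E.
Proof.
move=> mf f0.
rewrite -{1}setU_itv_pos ge0_integral_setU//; last 3 first.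
- by rewrite setU_itv_pos.
- by rewrite setU_itv_pos => t /=; rewrite in_itv/= andbT => /f0.
- exact: disj_itv_pos.
congr (_ + _)%E; rewrite (ge0_integral_translation h) ?subrr//.
  apply: measurable_funS mf => // t /=; rewrite !in_itv/= !andbT.
  exact: lt_trans.
by move=> t ht; apply: f0; exact: lt_trans ht.
Qed.

Lemma measurable_fun_translation d (T : measurableType d) (f : R -> T) :
  measurable_fun (`]0, +oo[ : set R) f -> measurable_fun (`]0, +oo[ : set R) (fun t => f (t + h)).
Proof.
move=> mf; apply: (measurable_comp (F := (`]0, +oo[ : set R))) => //.
- move=> t [s /=]; rewrite !in_itv/= !andbT => s0 <-; exact: addr_gt0.
- exact: measurable_funD.
Qed.

Lemma measurable_fun_glue d (T : measurableType d) (f g : R -> T) :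
  measurable_fun (`]0, +oo[ : set R) f -> measurable_fun (`]0, +oo[ : set R) g ->
  measurable_fun (`]0, +oo[ : set R) (glue_at h f g).
Proof.
move=> mf mg; rewrite -setU_itv_pos; apply/measurable_funU => //; split.
  apply: (eq_measurable_fun f).
    by move=> t; rewrite inE/= in_itv/= /glue_at => /andP[_ ->].
  apply: measurable_funS mf => // t /=; rewrite !in_itv/= !andbT.
  by move=> /andP[].
pose gh : R -> T := fun t => g (t - h).
apply: (eq_measurable_fun gh).
  by move=> t; rewrite inE/= in_itv/= andbT /glue_at; case: leP.
apply: (measurable_comp (F := (`]0, +oo[ : set R))) => //.
- by move=> t [s /=]; rewrite !in_itv/= !andbT => hs <-; rewrite subr_gt0.
- exact: measurable_funD.
Qed.

Lemma ge0_integral_glue (f g : R -> \bar R) : measurable_fun (`]0, +oo[ : set R) f ->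
  measurable_fun (`]0, +oo[ : set R) g ->
  (forall t : R, 0 < t -> (0 <= f t)%E) -> (forall t : R, 0 < t -> (0 <= g t)%E) ->
  (\int[mu]_(t in `]0%R, +oo[) glue_at h f g t = \int[mu]_(t in `]0%R, h]) f t +
    \int[mu]_(t in `]0%R, +oo[) g t)%E.
Proof.
move=> mf mg f0 g0; rewrite ge0_integral_split//; last 2 first.
- exact: measurable_fun_glue.
- by move=> t t0; rewrite /glue_at; case: (leP t h) => ht; [exact: f0|apply: g0; rewrite subr_gt0].
congr (_ + _)%E; apply: eq_integral => t; rewrite inE/= in_itv/= /glue_at.
  by move=> /andP[_ ->].
by rewrite andbT => t0; rewrite leNgt ltrDr t0 addrK.
Qed.

End glue_integral.

(** * Trajectories *)

Section trajectories.
Context {R : realType} {n p : nat}.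
Variables (A : 'M[R]_n) (B : 'M[R]_(n, p)).
Implicit Types (u v : R -> 'cV[R]_p) (x y : R -> 'cV[R]_n) (xi eta : 'cV[R]_n).
Local Notation mu := (@lebesgue_measure R).

Lemma trajectory_continuous xi u x (t : R) i : trajectory A B xi u x -> 0 < t ->
  {for t, continuous (fun s => x s i 0)}.
Proof.
move=> [_ ACx _] t0; apply: (@abs_continuous_continuous _ 0 (t + 1)).
  by apply: ACx; rewrite addr_gt0.
by rewrite t0 ltrDl /=.
Qed.

Lemma measurable_trajectory xi u x i : trajectory A B xi u x ->
  measurable_fun (`]0, +oo[ : set R) (fun t => x t i 0).
Proof.
move=> tx; apply: open_continuous_measurable_fun; first exact: interval_open.
move=> t; rewrite inE/= in_itv/= andbT => t0.
exact: trajectory_continuous tx t0.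
Qed.

Lemma trajectoryD xi eta u v x y :
  trajectory A B xi u x -> trajectory A B eta v y ->
  trajectory A B (xi + eta) (fun t => u t + v t) (fun t => x t + y t).
Proof.
move=> [x0 ACx dx] [y0 ACy dy]; split; first by rewrite x0 y0.
  move=> T i T0; have := abs_continuousD (ACx T i T0) (ACy T i T0).
  by congr (abs_continuous _ _ _); apply/funext => t; rewrite mxE.
move: dx dy; (apply: filterS2; first exact: (ae_filter_ringOfSetsType mu)) => t dx dy t0 i.
have -> : (fun s => (x s + y s) i 0) = (fun s => x s i 0) + (fun s => y s i 0).
  by apply/funext => s; rewrite mxE.
apply: is_derive_eq (is_deriveD (dx t0 i) (dy t0 i)) _.
by rewrite !mulmxDr !mxE; ring.
Qed.

Lemma trajectoryZ (c : R) xi u x : trajectory A B xi u x ->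
  trajectory A B (c *: xi) (fun t => c *: u t) (fun t => c *: x t).
Proof.
move=> [x0 ACx dx]; split; first by rewrite x0.
  move=> T i T0; have := abs_continuousZ c (ACx T i T0).
  by congr (abs_continuous _ _ _); apply/funext => t; rewrite mxE.
move: dx; (apply: filterS; first exact: (ae_filter_ringOfSetsType mu)) => t dx t0 i.
have -> : (fun s => (c *: x s) i 0) = c \*: (fun s => x s i 0).
  by apply/funext => s; rewrite mxE.
apply: is_derive_eq (is_deriveZ c (dx t0 i)) _.
by rewrite -!scalemxAr !mxE /GRing.scale/=; ring.
Qed.

Lemma trajectory_translation (h : R) xi u x : 0 <= h -> trajectory A B xi u x ->
  trajectory A B (x h) (fun t => u (t + h)) (fun t => x (t + h)).
Proof.
move=> h0 [x0 ACx dx]; split; first by rewrite add0r.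
  move=> T i T0.
  apply: (@abs_continuous_comp _ 0 T 0 (T + h) (fun t => x t i 0) (fun t => t + h)).
  - by apply: ACx; rewrite ltr_wpDr.
  - by move=> s t _ st _; rewrite opprD addrACA subrr addr0 subr_ge0 st/=.
  - by move=> t t0 tT; rewrite addr_ge0//= lerD2r.
have := ae_translation h dx.
(apply: filterS; first exact: (ae_filter_ringOfSetsType mu)) => t dxt t0 i.
have dh : is_derive t (1 : R) (fun s : R => s + h) 1.
  by apply: is_derive_eq (is_deriveD (is_derive_id _ _) (is_derive_cst _ _ _)) _; rewrite addr0.
have dx' := dxt (ltr_wpDr h0 t0) i.
have := @is_derive1_comp _ (fun s => x s i 0) (fun s => s + h) t _ _ dx' dh.
by rewrite mulr1.
Qed.

Lemma trajectory_glue (h : R) xi u v x y : 0 < h ->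
  trajectory A B xi u x -> trajectory A B (x h) v y ->
  trajectory A B xi (glue_at h u v) (glue_at h x y).
Proof.
move=> h0 tx ty; have ty' := ty.
move: (tx) ty => [x0 ACx dx] [y0 ACy dy].
split; first by rewrite /glue_at ltW.
  move=> T i T0.
  (* Since [y 0 = x h], the glued path is [x] stopped at [h] plus the increment of [y] after [h];
     both are compositions with admissible changes of time. *)
  have -> : (fun t => glue_at h x y t i 0) = (fun t => x (Num.min t h) i 0 +
      (y (Num.max (t - h) 0) i 0 + -1 * y 0 i 0)).
    apply/funext => t; rewrite /glue_at y0; case: leP => ht.
      by rewrite max_r ?subr_le0// y0 mulN1r subrr addr0.
    by rewrite max_l ?subr_ge0 1?ltW//; ring.
  apply: abs_continuousD; last apply: abs_continuousD.
  - apply: (@abs_continuous_comp _ 0 T 0 h (fun t => x t i 0) (fun t => Num.min t h)).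
    + exact: ACx.
    + by move=> s t _ st _; case: (leP s h); case: (leP t h); lra.
    + by move=> t t0 _; rewrite le_min t0 ge_min lexx orbT ltW.
  - apply: (@abs_continuous_comp _ 0 T 0 T (fun t => y t i 0) (fun t => Num.max (t - h) 0)).
    + exact: ACy.
    + by move=> s t _ st _; case: (leP (s - h) 0); case: (leP (t - h) 0); lra.
    + move=> t t0 tT; rewrite le_max lexx orbT ge_max (ltW T0) andbT lerBlDr.
      by rewrite (le_trans tT)// lerDl ltW.
  - exact: abs_continuous_cst.
have [_ _ dy'] := ty'.
have := ae_translation (- h) dy; move: dx (@ae_neq R h).
(apply: filterS3; first exact: (ae_filter_ringOfSetsType mu)) => t dxt th dyt t0 i.
have [lt_th|lt_ht] := ltP t h.
  have -> : glue_at h x y t = x t by rewrite /glue_at ltW.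
  have -> : glue_at h u v t = u t by rewrite /glue_at ltW.
  apply: near_eq_is_derive (dxt t0 i).
  near=> s; rewrite /glue_at ifT//; apply/ltW; near: s; exact: lt_nbhsl.
have {th}lt_ht : h < t by rewrite lt_neqAle eq_sym th.
have -> : glue_at h x y t = y (t - h) by rewrite /glue_at leNgt lt_ht.
have -> : glue_at h u v t = v (t - h) by rewrite /glue_at leNgt lt_ht.
have dh : is_derive t (1 : R) (fun s : R => s - h) 1.
  by apply: is_derive_eq (is_deriveD (is_derive_id _ _) (is_derive_cst _ _ _)) _; rewrite addr0.
have th0 : 0 < t - h by rewrite subr_gt0.
have dy1 := dyt th0 i.
have := @is_derive1_comp _ (fun s => y s i 0) (fun s => s - h) t _ _ dy1 dh.
rewrite mulr1; apply: near_eq_is_derive.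
near=> s; rewrite /glue_at ifF//; apply/negbTE; rewrite -ltNge; near: s; exact: lt_nbhsr.
Unshelve. all: by end_near. Qed.

(** The derivative holds at every [t], in particular at 0, where [trajectory] prescribes none and
    where [riccati_ge0] differentiates. *)
Lemma constant_control_trajectory (w : 'cV[R]_p) xi : exists x : R -> 'cV[R]_n,
  [/\ trajectory A B xi (fun=> w) x,
    (forall t i, is_derive t (1 : R) (fun s => x s i 0) ((A *m x t + B *m w) i 0))
    & x 0 = xi].
Proof.
have [x [x0 dx]] := affine_ode_solution A (B *m w) xi.
exists x; split => //; split => //; last by apply: aeW => t _ i; exact: dx.
move=> T i T0.
apply: (@abs_continuous_derivable _ _ _ _ (fun t => (A *m x t + B *m w) i 0)) => //.
  exact: ltW.
have cx j : continuous (fun s => x s j 0).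
  move=> t; apply/differentiable_continuous/derivable1_diffP.
  exact: (@ex_derive _ _ _ _ _ _ _ (dx t j)).
move=> t; rewrite (_ : (fun t => _) = (fun t => \sum_j A i j * x t j 0 + (B *m w) i 0)); last first.
  by apply/funext => s; rewrite mxE mxE.
apply: cvgD; last exact: cvg_cst.
apply: cvg_big => [|j _]; first exact: add_continuous.
by apply: cvgMl_tmp; exact: cx.
Qed.

End trajectories.

(** * The value function *)

Section measurability.
Context {R : realType}.
Local Notation D := (`]0, +oo[%classic : set R).

Lemma measurable_fun_mulmx {m n : nat} (K : 'M[R]_(m, n)) (v : R -> 'cV[R]_n) :
  (forall i, measurable_fun D (fun t => v t i 0)) ->
  forall i, measurable_fun D (fun t => (K *m v t) i 0).
Proof.
move=> mv i; rewrite (_ : (fun t => _) = (fun t => \sum_j K i j * v t j 0)).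
  by apply: measurable_sum => j; exact: measurable_funM.
by apply/funext => t; rewrite mxE.
Qed.

Lemma measurable_fun_dotp {n : nat} (v : R -> 'cV[R]_n) :
  (forall i, measurable_fun D (fun t => v t i 0)) ->
  measurable_fun D (fun t => dotp (v t) (v t)).
Proof. by move=> mv; apply: measurable_sum => i; exact: measurable_funM. Qed.

Lemma measurable_fun_sqr_enorm {n : nat} (v : R -> 'cV[R]_n) :
  (forall i, measurable_fun D (fun t => v t i 0)) ->
  measurable_fun D (fun t => (enorm (v t) ^+ 2)%:E).
Proof.
move=> mv; rewrite (_ : (fun t => _) = EFin \o (fun t => dotp (v t) (v t))).
  by apply/measurable_EFinP; exact: measurable_fun_dotp.
by apply/funext => t; rewrite /= enorm_sqr.
Qed.

End measurability.

Section L2_controls.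
Context {R : realType} {p : nat}.
Implicit Types u v : R -> 'cV[R]_p.
Local Notation mu := (@lebesgue_measure R).

Lemma L2_controlZ (c : R) u : L2_control u -> L2_control (fun t => c *: u t).
Proof.
move=> [mu_ iu]; split.
  move=> i; rewrite (_ : (fun t => _) = (fun t => c * u t i 0)).
    exact: measurable_funM.
  by apply/funext => t; rewrite mxE.
under eq_integral do rewrite enorm_sqr dotpZl dotpZr mulrA -expr2 -enorm_sqr EFinM.
rewrite ge0_integralZl//; first by rewrite lte_mul_pinfty// lee_fin sqr_ge0.
- exact: measurable_fun_sqr_enorm.
- by move=> t _; rewrite lee_fin sqr_ge0.
- by rewrite lee_fin sqr_ge0.
Qed.

Lemma L2_controlD u v : L2_control u -> L2_control v ->
  L2_control (fun t => u t + v t).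
Proof.
move=> [mu_ iu] [mv iv].
have muv i : measurable_fun (`]0, +oo[ : set R) (fun t => (u t + v t) i 0).
  rewrite (_ : (fun t => _) = (fun t => u t i 0 + v t i 0)).
    exact: measurable_funD.
  by apply/funext => t; rewrite mxE.
split => //.
apply: (@le_lt_trans _ _ (\int[mu]_(t in `]0%R, +oo[)
    (2%:E * ((enorm (u t)) ^+ 2)%:E + 2%:E * ((enorm (v t)) ^+ 2)%:E))%E).
  apply: ge0_le_integral => //.
  - by move=> t _; rewrite lee_fin sqr_ge0.
  - exact: measurable_fun_sqr_enorm.
  - by apply: emeasurable_funD; apply: measurable_funeM; exact: measurable_fun_sqr_enorm.
  - move=> t _; rewrite -!EFinM -EFinD lee_fin !enorm_sqr dotpDl !dotpDr.
    have := dotp_ge0 (u t - v t); rewrite dotpDl !dotpDr !dotpNl !dotpNr (dotpC (v t)).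
    lra.
rewrite ge0_integralD//; [|by move=> t _; rewrite mule_ge0// lee_fin sqr_ge0
  |by apply: measurable_funeM; exact: measurable_fun_sqr_enorm
  |by move=> t _; rewrite mule_ge0// lee_fin sqr_ge0
  |by apply: measurable_funeM; exact: measurable_fun_sqr_enorm].
rewrite !ge0_integralZl//; first by rewrite lte_add_pinfty// lte_mul_pinfty.
all: try exact: measurable_fun_sqr_enorm.
all: by move=> t _; rewrite lee_fin sqr_ge0.
Qed.

End L2_controls.

Definition running_cost {R : realType} {n p m : nat} (C : 'M[R]_(m, n))
    (u : R -> 'cV[R]_p) (x : R -> 'cV[R]_n) (t : R) : R :=
  enorm (C *m x t) ^+ 2 + enorm (u t) ^+ 2.

Section value_function.
Context {R : realType} {n p m : nat}.
Variables (A : 'M[R]_n) (B : 'M[R]_(n, p)) (C : 'M[R]_(m, n)).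
Hypothesis hfin : finite_cost_condition A B C.
Implicit Types (u v : R -> 'cV[R]_p) (x y : R -> 'cV[R]_n) (xi eta : 'cV[R]_n).
Local Notation mu := (@lebesgue_measure R).
Local Notation l := (running_cost C).

Lemma running_cost_ge0 u x t : 0 <= l u x t.
Proof. by rewrite addr_ge0 ?sqr_ge0. Qed.

Lemma measurable_running_cost xi u x :
  (forall i, measurable_fun (`]0, +oo[ : set R) (fun t => u t i 0)) ->
  trajectory A B xi u x ->
  measurable_fun (`]0, +oo[ : set R) (fun t => (l u x t)%:E).
Proof.
move=> mu_ tx.
rewrite (_ : (fun t => _) = ((fun t => (enorm (C *m x t) ^+ 2)%:E) \+
  (fun t => (enorm (u t) ^+ 2)%:E))%E)//.
apply: emeasurable_funD; apply: measurable_fun_sqr_enorm => //.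
by apply: measurable_fun_mulmx => i; exact: measurable_trajectory tx.
Qed.

Lemma value_ge0 xi : (0 <= value A B C xi)%E.
Proof.
apply: le_ereal_inf_tmp => _ [u [x [_ ->]]].
by apply: integral_ge0 => t _; rewrite lee_fin running_cost_ge0.
Qed.

Lemma value_le_cost xi u x : admissible A B xi u x -> (value A B C xi <= cost C u x)%E.
Proof. by move=> ux; apply: ereal_inf_lbound; exists u, x. Qed.

(** The finite cost condition enters here and makes the value function real-valued. *)
Lemma value_fin xi : value A B C xi \is a fin_num.
Proof.
have [u [x [ux cux]]] := hfin xi.
by rewrite ge0_fin_numE ?value_ge0// (le_lt_trans _ cux)// value_le_cost.
Qed.

Definition fine_value xi : R := fine (value A B C xi).
Local Notation V := fine_value.

Lemma valueE xi : value A B C xi = (V xi)%:E.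
Proof. by rewrite fineK// value_fin. Qed.

Lemma near_optimal xi (e : R) : 0 < e ->
  exists u x, admissible A B xi u x /\ (cost C u x < (V xi + e)%:E)%E.
Proof.
move=> e0; have [_ [u [x [ux ->]]] ce] := lb_ereal_inf_adherent e0 (value_fin xi).
by exists u, x; split => //; rewrite EFinD -valueE.
Qed.

Lemma fine_value_ge0 xi : 0 <= V xi.
Proof. by rewrite fine_ge0// value_ge0. Qed.

Lemma admissibleD xi eta u v x y :
  admissible A B xi u x -> admissible A B eta v y ->
  admissible A B (xi + eta) (fun t => u t + v t) (fun t => x t + y t).
Proof.
by move=> [Lu tx] [Lv ty]; split; [exact: L2_controlD|exact: trajectoryD].
Qed.

Lemma admissibleZ (c : R) xi u x : admissible A B xi u x ->
  admissible A B (c *: xi) (fun t => c *: u t) (fun t => c *: x t).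
Proof.
by move=> [Lu tx]; split; [exact: L2_controlZ|exact: trajectoryZ].
Qed.

Lemma costZ (c : R) xi u x : admissible A B xi u x ->
  cost C (fun t => c *: u t) (fun t => c *: x t) = ((c ^+ 2)%:E * cost C u x)%E.
Proof.
move=> [[mu_ _] tx]; rewrite /cost -ge0_integralZl//; first last.
- by rewrite lee_fin sqr_ge0.
- by move=> t _; rewrite lee_fin running_cost_ge0.
- exact: measurable_running_cost tx.
apply: eq_integral => t _; rewrite -EFinM -scalemxAr !enorm_sqr.
by rewrite !dotpZl !dotpZr; congr (_%:E); ring.
Qed.

(** The identity holds pointwise for the integrands. The difference is written with [-1 *:] to match
    [admissibleZ]. *)
Lemma cost_parallelogram xi eta u v x y :
  admissible A B xi u x -> admissible A B eta v y ->
  (cost C (fun t => u t + v t)%R (fun t => x t + y t)%R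
    + cost C (fun t => u t + -1 *: v t)%R (fun t => x t + -1 *: y t)%R
  = 2%:E * cost C u x + 2%:E * cost C v y)%E.
Proof.
move=> ux vy.
have mc := fun xi u x (H : admissible A B xi u x) => measurable_running_cost H.1.1 H.2.
have m1 := mc _ _ _ ux; have m2 := mc _ _ _ vy.
have m3 := mc _ _ _ (admissibleD ux vy).
have m4 := mc _ _ _ (admissibleD ux (admissibleZ (-1) vy)).
rewrite /cost -!ge0_integralZl//; try (by move=> *; rewrite lee_fin addr_ge0 ?sqr_ge0).
rewrite -!ge0_integralD//; try exact: measurable_funeM;
  try (by move=> *; rewrite ?mule_ge0// lee_fin addr_ge0 ?sqr_ge0).
apply: eq_integral => t _; rewrite -!EFinM -!EFinD; congr (_%:E).
rewrite !enorm_sqr !scaleN1r !mulmxDr !mulmxN !dotpDl !dotpDr !dotpNl !dotpNr.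
rewrite (dotpC (C *m y t)) (dotpC (v t)) //; ring.
Qed.

Lemma fine_value_le xi u x (c : R) : admissible A B xi u x ->
  (cost C u x <= c%:E)%E -> V xi <= c.
Proof.
by move=> ux cc; rewrite -lee_fin -valueE (le_trans (value_le_cost ux)).
Qed.

Lemma fine_valueZ (c : R) xi : V (c *: xi) = c ^+ 2 * V xi.
Proof.
have le_V d eta : V (d *: eta) <= d ^+ 2 * V eta.
  apply/ler_addgt0Pr => e e0.
  (* The error [e / (d ^+ 2 + 1)] stays below [e] after multiplication by [d ^+ 2], even for
     [d = 0]. *)
  have d1 : 0 < d ^+ 2 + 1 by rewrite ltr_wpDl// sqr_ge0.
  have [u [x [ux ce]]] := near_optimal eta (divr_gt0 e0 d1).
  apply: (fine_value_le (admissibleZ d ux)); rewrite (costZ d ux).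
  apply: (@le_trans _ _ ((d ^+ 2)%:E * (V eta + e / (d ^+ 2 + 1))%:E)%E).
    by rewrite lee_wpmul2l ?lee_fin ?sqr_ge0// ltW.
  rewrite -EFinM lee_fin mulrDr lerD2l.
  have := sqr_ge0 d; rewrite mulrA ler_pdivrMr//; nra.
have [->|c0] := eqVneq c 0.
  rewrite scale0r expr0n mul0r; apply/le_anti; rewrite fine_value_ge0 andbT.
  by have := le_V 0 xi; rewrite scale0r expr0n mul0r.
apply/le_anti; rewrite le_V/=.
have := le_V c^-1 (c *: xi); rewrite scalerA mulVf// scale1r.
by rewrite exprVn -ler_pdivrMl ?invrK// invr_gt0 exprn_even_gt0.
Qed.

(** Nearly optimal pairs give one inequality. Applied to [xi + eta] and [xi - eta], with homogeneity
    of degree 2, it gives the other. *)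
Lemma fine_value_parallelogram xi eta :
  V (xi + eta) + V (xi - eta) = 2 * V xi + 2 * V eta.
Proof.
have leP z w : V (z + w) + V (z - w) <= 2 * V z + 2 * V w.
  apply/ler_addgt0Pr => e e0.
  have e4 : 0 < e / 4 by rewrite divr_gt0.
  have [u [x [ux cu]]] := near_optimal z e4.
  have [v [y [vy cv]]] := near_optimal w e4.
  rewrite -lee_fin EFinD -!valueE -(scaleN1r w).
  apply: (le_trans (leeD (value_le_cost (admissibleD ux vy))
    (value_le_cost (admissibleD ux (admissibleZ (-1) vy))))).
  rewrite (cost_parallelogram ux vy).
  apply: (@le_trans _ _ (2%:E * (V z + e / 4)%:E + 2%:E * (V w + e / 4)%:E)%E).
    by apply: leeD; rewrite lee_wpmul2l ?lee_fin// ltW.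
  by rewrite -!EFinM -EFinD lee_fin; lra.
apply/le_anti; rewrite leP/=.
have := leP (xi + eta) (xi - eta).
have -> : xi + eta + (xi - eta) = 2 *: xi.
  by rewrite addrACA subrr addr0 scaler_nat mulr2n.
have -> : xi + eta - (xi - eta) = 2 *: eta.
  by apply/matrixP => i j; rewrite !mxE; ring.
rewrite !fine_valueZ; lra.
Qed.

Lemma fine_value_quadratic : exists P : 'M[R]_n,
  P^T = P /\ forall xi, dotp (P *m xi) xi = V xi.
Proof.
exact: (parallelogram_quadratic fine_value_ge0 fine_valueZ fine_value_parallelogram).
Qed.

(** * The two inequalities of dynamic programming *)

Section dynamic_programming.
Variable h : R.
Hypothesis h0 : 0 < h.

(** Follow [u] up to time [h], then a nearly optimal control from [x h]. Integrability of [u] is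
    asked on (0, h] alone, through [J], so that constant controls qualify. *)
Lemma fine_value_le_prefix xi u x (J : R) : trajectory A B xi u x ->
  (forall i, measurable_fun (`]0, +oo[ : set R) (fun t => u t i 0)) ->
  (\int[mu]_(t in `]0%R, h]) (l u x t)%:E <= J%:E)%E ->
  V xi <= J + V (x h).
Proof.
move=> tx mu_ lJ; apply/ler_addgt0Pr => e e0.
have [v [y [vy ce]]] := near_optimal (x h) e0.
have ml := measurable_running_cost mu_ tx.
have lu : (\int[mu]_(t in `]0%R, h]) (enorm (u t) ^+ 2)%:E <= J%:E)%E.
  apply: le_trans lJ; apply: ge0_le_integral => //.
  - by move=> t _; rewrite lee_fin sqr_ge0.
  - apply: measurable_funS (measurable_fun_sqr_enorm mu_) => // t /=.
    by rewrite !in_itv/= andbT => /andP[].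
  - apply: measurable_funS ml => // t /=.
    by rewrite !in_itv/= andbT => /andP[].
  - by move=> t _; rewrite lee_fin lerDr sqr_ge0.
have adm : admissible A B xi (glue_at h u v) (glue_at h x y).
  split; last exact: trajectory_glue h0 tx vy.2.
  split.
    move=> i; rewrite (_ : (fun t => _) =
      glue_at h (fun t => u t i 0) (fun t => v t i 0)).
      by apply: measurable_fun_glue => //; exact: vy.1.1.
    by apply/funext => t; rewrite /glue_at; case: ifP.
  rewrite (_ : (fun t => _) = glue_at h (fun t => (enorm (u t) ^+ 2)%:E)
    (fun t => (enorm (v t) ^+ 2)%:E)); last first.
    by apply/funext => t; rewrite /glue_at; case: ifP.
  rewrite ge0_integral_glue//.
  - by rewrite lte_add_pinfty// ?(le_lt_trans lu) ?ltry//; exact: vy.1.2.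
  - exact: measurable_fun_sqr_enorm.
  - by apply: measurable_fun_sqr_enorm; exact: vy.1.1.
  - by move=> t _; rewrite lee_fin sqr_ge0.
  - by move=> t _; rewrite lee_fin sqr_ge0.
apply: (fine_value_le adm); rewrite /cost.
rewrite (_ : (fun t => _) =
    glue_at h (fun t => (l u x t)%:E) (fun t => (l v y t)%:E)); last first.
  by apply/funext => t; rewrite /glue_at; case: ifP.
rewrite ge0_integral_glue//.
- by apply: (le_trans (leeD lJ (ltW ce))); rewrite -EFinD lee_fin addrA.
- exact: measurable_running_cost vy.1.1 vy.2.
- by move=> t _; rewrite lee_fin running_cost_ge0.
- by move=> t _; rewrite lee_fin running_cost_ge0.
Qed.

(** The tail after [h], shifted back to time 0, is admissible from [x h] and costs at least
    [V (x h)]. *)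
Lemma prefix_le_cost xi u x : admissible A B xi u x ->
  (\int[mu]_(t in `]0%R, h]) (l u x t)%:E + (V (x h))%:E <= cost C u x)%E.
Proof.
move=> [[mu_ iu] tx]; rewrite /cost (ge0_integral_split h0); first last.
- by move=> t _; rewrite lee_fin running_cost_ge0.
- exact: measurable_running_cost tx.
rewrite leeD2l// -valueE; apply: value_le_cost; split.
  split; first by move=> i; exact: (measurable_fun_translation h0 (mu_ i)).
  apply: le_lt_trans iu; rewrite [leRHS](ge0_integral_split h0).
  - rewrite leeDr//; apply: integral_ge0 => t _; by rewrite lee_fin sqr_ge0.
  - exact: measurable_fun_sqr_enorm.
  - by move=> t _; rewrite lee_fin sqr_ge0.
by apply: trajectory_translation tx; exact: ltW.
Qed.

End dynamic_programming.

End value_function.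

(** * Derivatives *)

(** Lebesgue differentiation of the accumulated cost. Monotonicity and the derivative almost
    everywhere are what [le_of_ae_derive_ge0] asks of [G]. *)
Lemma ae_derivable_primitive {R : realType} (f : R -> R) :
  measurable_fun (`]0, +oo[ : set R) (fun t => (f t)%:E) ->
  (forall t : R, 0 <= f t) ->
  (\int[lebesgue_measure]_(t in `]0%R, +oo[) (f t)%:E < +oo)%E ->
  exists F : R -> R,
    [/\ forall t, (\int[lebesgue_measure]_(s in `]0%R, t]) (f s)%:E = (F t)%:E)%E,
      F 0 = 0, forall s t, s <= t -> F s <= F t &
      {ae lebesgue_measure, forall t : R, 0 < t -> is_derive t (1 : R) F (f t)}].
Proof.
move=> mf f0 foo.
set D := (`]0, +oo[%classic : set R).
have mD : measurable D by exact: measurable_itv.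
have iD : lebesgue_measure.-integrable D (EFin \o f).
  apply/integrableP; split => //.
  rewrite (_ : (fun t => _) = (fun t => (f t)%:E))//.
  by apply/funext => t; rewrite /= ger0_norm.
(* Extension by zero, integrable on the whole line. *)
pose g : R -> R := f \_ D.
have ig : lebesgue_measure.-integrable setT (EFin \o g).
  by rewrite /g -restrict_EFin;
    have [+ _] := integrable_mkcond (mu := lebesgue_measure) (EFin \o f) mD; exact.
have subD t : `]0, t] `<=` D by move=> s; rewrite /D /= !in_itv/= andbT => /andP[].
have intE t : (\int[lebesgue_measure]_(s in `]0%R, t]) (f s)%:E =
    \int[lebesgue_measure]_(s in `]0%R, t]) (g s)%:E)%E.
  apply: eq_integral => s; rewrite inE => st.
  by rewrite /g patchE mem_set//; exact: subD st.
have it t : lebesgue_measure.-integrable (`]0, t]%classic : set R) (EFin \o f).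
  apply: (@integrableS _ _ _ (@lebesgue_measure R) D) => //.
pose F t := \int[lebesgue_measure]_(s in `]0, t]) g s.
have FE t : (\int[lebesgue_measure]_(s in `]0%R, t]) (f s)%:E = (F t)%:E)%E.
  by rewrite /F /Rintegral -intE fineK//; exact: integrable_fin_num (it t).
exists F; split => //.
- by rewrite /F set_itv_ge ?bnd_simp// Rintegral_set0.
- move=> s t st; rewrite -lee_fin -!FE; apply: ge0_subset_integral => //.
  + exact: (measurable_int _ (it t)).
  + by move=> r _; rewrite lee_fin.
  + by apply: subset_itvl; rewrite bnd_simp.
have intg y : lebesgue_measure.-integrable [set` Interval (BRight (0 : R)) (BRight y)] (EFin \o g).
  by apply: (@integrableS _ _ _ (@lebesgue_measure R) setT).
have locg := open_integrable_locally openT ig.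
have := FTC1 intg locg.
apply: filterS; first exact: (ae_filter_ringOfSetsType lebesgue_measure).
move=> t Ht t0; have [|dF dFE] := Ht; first exact: t0.
apply: DeriveDef => //; rewrite -derive1E dFE /g patchE mem_set//.
by rewrite /D /= in_itv/= andbT.
Qed.

Lemma is_derive_le0 {R : realType} (f : R -> R) (t d r : R) :
  is_derive t (1 : R) f d -> 0 < r ->
  (forall h, 0 < h -> h < r -> f (t + h) <= f t) -> d <= 0.
Proof.
move=> df r0 fle; rewrite leNgt; apply/negP => d0.
have d2 : 0 < d / 2 by rewrite divr_gt0.
have [g g0 gP] := is_derive_littleo df d2.
pose h := Num.min g r / 2.
have m0 : 0 < Num.min g r by rewrite lt_min g0.
have h0 : 0 < h by rewrite divr_gt0.
have hm : h < Num.min g r by rewrite gtr_pMr// invf_lt1// ltr1n.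
move: (hm); rewrite lt_min => /andP[hg hr].
have := gP (t + h); rewrite addrAC subrr add0r (gtr0_norm h0) => /(_ hg).
by rewrite ler_norml => /andP[+ _]; have := fle h h0 hr; nra.
Qed.

Lemma is_derive_usc {R : realType} (f : R -> R) (t d e : R) :
  is_derive t (1 : R) f d -> 0 < e ->
  exists2 r, 0 < r & forall s, `|s - t| < r -> f s <= f t + e.
Proof.
move=> df e0; have [g g0 gP] := is_derive_littleo df ltr01.
have d1 : 0 < `|d| + 1 by rewrite ltr_wpDl.
exists (Num.min g (e / (`|d| + 1))); first by rewrite lt_min g0 divr_gt0.
move=> s; rewrite lt_min => /andP[/gP + se].
rewrite mul1r ler_norml => /andP[_].
have : d * (s - t) <= `|d| * `|s - t| by rewrite -normrM ler_norm.
by move: se; rewrite ltr_pdivlMr//; lra.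
Qed.

Section vector_derivative.
Context {R : realType}.

(** Componentwise, so that the differential equation in [trajectory] is directly of this form. *)
Definition vderive {n : nat} (t : R) (f : R -> 'cV[R]_n) (d : 'cV[R]_n) :=
  forall i, is_derive t (1 : R) (fun s => f s i 0) (d i 0).

Lemma vderive_mulmx {n m : nat} (K : 'M[R]_(m, n)) t f d :
  vderive t f d -> vderive t (fun s => K *m f s) (K *m d).
Proof.
move=> df i.
have -> : (fun s => (K *m f s) i 0) = \sum_(j < n) (K i j \*: (fun s => f s j 0)).
  by apply/funext => s; rewrite mxE fct_sumE; apply: eq_bigr.
apply: is_derive_eq (is_derive_sum (fun j => is_deriveZ (K i j) (df j))) _.
by rewrite mxE; apply: eq_bigr.
Qed.

Lemma is_derive_dotp {n : nat} t (f g : R -> 'cV[R]_n) d e :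
  vderive t f d -> vderive t g e ->
  is_derive t (1 : R) (fun s => dotp (f s) (g s)) (dotp d (g t) + dotp (f t) e).
Proof.
move=> df dg.
have -> : (fun s => dotp (f s) (g s)) =
    \sum_(i < n) ((fun s => f s i 0) * (fun s => g s i 0)).
  by apply/funext => s; rewrite fct_sumE; apply: eq_bigr.
apply: is_derive_eq (is_derive_sum (fun i => is_deriveM (df i) (dg i))) _.
rewrite -big_split; apply: eq_bigr => i _.
by rewrite addrC /GRing.scale/= [_ * d i 0]mulrC.
Qed.

Lemma is_derive_quadratic {n : nat} (P : 'M[R]_n) t (f : R -> 'cV[R]_n) d :
  P^T = P -> vderive t f d ->
  is_derive t (1 : R) (fun s => dotp (P *m f s) (f s)) (2 * dotp (P *m f t) d).
Proof.
move=> Psym df.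
apply: is_derive_eq (is_derive_dotp (vderive_mulmx P df) df) _.
by rewrite dotp_mull Psym dotpC mulr_natl mulr2n.
Qed.

(** Time reversal for the adjoint state, which is solved forward from time 0 and used at [h - t]. *)
Lemma vderive_reflection {n : nat} (h t : R) (f : R -> 'cV[R]_n) d :
  vderive (h - t) f d -> vderive t (fun s => f (h - s)) (- d).
Proof.
move=> df i.
have dh : is_derive t (1 : R) (fun s : R => h - s) (-1).
  apply: is_derive_eq (is_deriveB (is_derive_cst _ _ _) (is_derive_id _ _)) _.
  by rewrite sub0r.
have := @is_derive1_comp _ (fun s => f s i 0) (fun s => h - s) t _ _ (df i) dh.
by rewrite mulrN1 mxE.
Qed.

Lemma vderive_continuous {n : nat} (f d : R -> 'cV[R]_n) i :
  (forall t, vderive t f (d t)) -> continuous (fun s => f s i 0).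
Proof.
move=> df t; apply/differentiable_continuous/derivable1_diffP.
exact: (@ex_derive _ _ _ _ _ _ _ (df t i)).
Qed.

End vector_derivative.

(** * The Riccati equation *)

Lemma is_derive_linear {R : realType} (k t : R) :
  is_derive t (1 : R) (fun s => k * s) k.
Proof.
rewrite (_ : (fun s => k * s) = k \*: (@id R)) //.
by apply: is_derive_eq (is_deriveZ k (is_derive_id t 1)) _; exact: mulr1.
Qed.

Definition riccati {R : realType} {n p m : nat} (A : 'M[R]_n) (B : 'M[R]_(n, p))
    (C : 'M[R]_(m, n)) (P : 'M[R]_n) : 'M[R]_n :=
  A^T *m P + P *m A - P *m B *m B^T *m P + C^T *m C.

Section riccati_equation.
Context {R : realType} {n p m : nat}.
Variables (A : 'M[R]_n) (B : 'M[R]_(n, p)) (C : 'M[R]_(m, n)) (P : 'M[R]_n).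
Hypothesis hfin : finite_cost_condition A B C.
Hypothesis Psym : P^T = P.
Hypothesis PV : forall xi, dotp (P *m xi) xi = fine_value A B C xi.
Implicit Types (u v : R -> 'cV[R]_p) (x y : R -> 'cV[R]_n) (xi eta : 'cV[R]_n).
Local Notation mu := (@lebesgue_measure R).
Local Notation l := (running_cost C).
Local Notation V := (fine_value A B C).

Lemma riccati_form xi : dotp (riccati A B C P *m xi) xi =
  2 * dotp (P *m xi) (A *m xi) - dotp (B^T *m P *m xi) (B^T *m P *m xi)
  + dotp (C *m xi) (C *m xi).
Proof.
rewrite /riccati !mulmxDl mulNmx !dotpDl dotpNl -!mulmxA.
rewrite (dotp_mull A^T) (dotp_mull P (A *m xi)) (dotp_mull P (B *m _)).
rewrite (dotp_mull B) (dotp_mull C^T) !trmxK Psym (dotpC (A *m xi)); ring.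
Qed.

(** The left-hand side is the running cost plus the derivative of [V] at [xi] in the direction
    [A *m xi + B *m w]. *)
Lemma completed_square xi w :
  dotp (C *m xi) (C *m xi) + dotp w w + 2 * dotp (P *m xi) (A *m xi + B *m w) =
  dotp (w + B^T *m P *m xi) (w + B^T *m P *m xi) + dotp (riccati A B C P *m xi) xi.
Proof.
rewrite riccati_form !dotpDl !dotpDr (dotpC (P *m xi) (B *m w)).
by rewrite (dotp_mull B w) mulmxA (dotpC (B^T *m P *m xi) w); ring.
Qed.

(** Convexity: [V (eta - xi) >= 0], expanded, puts [V] above its tangent at [xi]. *)
Lemma linear_lower_bound xi eta :
  2 * dotp (P *m xi) eta - dotp (P *m xi) xi <= dotp (P *m eta) eta.
Proof.
have := fine_value_ge0 A B C (eta - xi); rewrite -PV.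
rewrite mulmxDr mulmxN !dotpDl !dotpDr !dotpNl !dotpNr.
by rewrite (dotp_mull P eta xi) Psym (dotpC eta); lra.
Qed.

(** For small [h], dynamic programming gives [V xi <= kappa * h + V (x h)]. Thus
    [- kappa * t - V (x t)] has a derivative at most 0 at time 0, and the completed square
    identifies it as [- <S xi, xi> - e]. *)
Lemma riccati_ge0 xi : 0 <= dotp (riccati A B C P *m xi) xi.
Proof.
rewrite -oppr_le0; apply/ler_addgt0Pr => e e0; rewrite add0r.
(* The control for which the completed square vanishes at [xi]. *)
pose w := - (B^T *m P *m xi).
have [x [tx dx x0]] := constant_control_trajectory A B w xi.
have dC : is_derive 0 (1 : R) (fun t => dotp (C *m x t) (C *m x t)) _ :=
  is_derive_dotp (vderive_mulmx C (dx 0)) (vderive_mulmx C (dx 0)).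
have [r r0 Cr] := is_derive_usc dC e0.
pose kappa := dotp (C *m xi) (C *m xi) + e + dotp w w.
have dV := is_derive_quadratic Psym (dx 0).
have df : is_derive 0 (1 : R)
    (fun t => - kappa * t - dotp (P *m x t) (x t)) _ :=
  is_deriveB (is_derive_linear (- kappa) 0) dV.
have := is_derive_le0 df r0; rewrite x0 => H.
have : - kappa - 2 * dotp (P *m xi) (A *m xi + B *m w) <= 0.
  apply: H => h h0 hr; rewrite add0r mulr0 sub0r !PV.
  have : V xi <= kappa * h + V (x h).
    have mw i : measurable_fun (`]0, +oo[ : set R) (fun=> w i 0).
      exact: measurable_cst.
    apply: (fine_value_le_prefix hfin h0 tx mw).
    apply: (@le_trans _ _ (\int[mu]_(t in `]0%R, h]) (cst kappa%:E) t)%E).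
      apply: ge0_le_integral => //.
      - by move=> t _; rewrite lee_fin running_cost_ge0.
      - apply: measurable_funS (measurable_running_cost C mw tx) => // t /=.
        by rewrite !in_itv/= andbT => /andP[].
      - move=> t /=; rewrite in_itv/= => /andP[t0 th].
        rewrite lee_fin /running_cost !enorm_sqr lerD2r -x0; apply: Cr.
        by rewrite subr0 gtr0_norm// (le_lt_trans th).
    rewrite integral_cst//= lebesgue_measure_itv/= lte_fin h0.
    by rewrite -EFinB -EFinM lee_fin subr0.
  by lra.
rewrite -(subr_ge0 _ e); have := completed_square xi w.
rewrite /w addNr dotp0l add0r /kappa /w; lra.
Qed.

(* With p t = q (h - t), completing squares gives
     |C x|^2 + |u|^2 >= 2 <C xi, C x> - |C xi|^2 - 2 <B^T p, u> - |B^T p|^2,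
   and the terms of the right-hand side that depend on x or u are the
   derivative of - 2 <p, x>. *)
Lemma dual_bound xi (q : R -> 'cV[R]_n) (kappa h : R) :
  q 0 = P *m xi ->
  (forall t, vderive t q (A^T *m q t + C^T *m C *m xi)) ->
  0 < h ->
  (forall s, 0 < s -> s < h ->
    dotp (C *m xi) (C *m xi) + dotp (B^T *m q s) (B^T *m q s) <= kappa) ->
  2 * dotp (q h) xi <= 2 * dotp (P *m xi) xi + kappa * h.
Proof.
move=> q0 dq h0 kB; apply/ler_addgt0Pr => e e0.
have [u [x [ux ce]]] := near_optimal hfin xi e0.
have [[[mu_ iu] tx] x0] : admissible A B xi u x /\ x 0 = xi by split => //; case: ux.2.
have cfin : (cost C u x < +oo)%E by rewrite (lt_trans ce)// ltry.
have [F [FE F0 Fnd dF]] := ae_derivable_primitive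
  (measurable_running_cost C mu_ tx) (running_cost_ge0 C u x) cfin.
have Fh : F h + V (x h) <= V xi + e.
  rewrite -lee_fin EFinD -FE (le_trans _ (ltW ce))//.
  exact: (prefix_le_cost hfin h0 ux).
(* Almost everywhere [F + phi] has a nonnegative derivative: after completing squares, [kappa]
   absorbs the remaining negative terms. *)
pose phi t := 2 * dotp (q (h - t)) (x t) + kappa * t.
have ACphi : abs_continuous 0 h phi.
  apply: abs_continuousD; last exact/abs_continuousZ/abs_continuous_id.
  apply: abs_continuousZ; apply: abs_continuous_sum => i.
  apply: abs_continuousM; [exact: ltW| |by have [_ + _] := tx; exact].
  apply: (@abs_continuous_derivable _ _ _ _
    (fun t => (- (A^T *m q (h - t) + C^T *m C *m xi)) i 0)); first exact: ltW.
    by move=> t; exact: vderive_reflection (dq (h - t)) i.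
  move=> t.
  have cq j : continuous (fun s => q (h - s) j 0).
    apply: (@vderive_continuous _ _ (fun s => q (h - s))
      (fun s => - (A^T *m q (h - s) + C^T *m C *m xi))) => s.
    exact: vderive_reflection.
  rewrite (_ : (fun t => _) = (fun t =>
      - (\sum_j A^T i j * q (h - t) j 0 + (C^T *m C *m xi) i 0))); last first.
    by apply/funext => s; rewrite 3!mxE.
  apply: cvgN; apply: cvgD; last exact: cvg_cst.
  apply: cvg_big => [|j _]; first exact: add_continuous.
  by apply: cvgMl_tmp; exact: cq.
have : F 0 + phi 0 <= F h + phi h.
  apply: (@le_of_ae_derive_ge0 _ 0 h F phi) => //.
  - exact: ltW.
  - by move=> s t _ st _; exact: Fnd.
  have [_ _ dx] := tx; move: dF dx.
  apply: filterS2; first exact: (ae_filter_ringOfSetsType mu).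
  move=> t dFt dxt /andP[t0 th].
  have dq' := vderive_reflection (dq (h - t)).
  have dqx := is_derive_dotp dq' (dxt t0).
  have dphi := is_deriveD (dFt t0)
    (is_deriveD (is_deriveZ 2 dqx) (is_derive_linear kappa t)).
  exists (l u x t + (2 *: (dotp (- (A^T *m q (h - t) + C^T *m C *m xi)) (x t)
     + dotp (q (h - t)) (A *m x t + B *m u t)) + kappa)).
    have hB := kB (h - t); rewrite subr_gt0 ltrBlDr ltrDl in hB.
    have {hB} := hB th t0; set s := q (h - t).
    rewrite /running_cost !enorm_sqr /GRing.scale/=.
    rewrite dotpNl dotpDl (dotp_mull A^T) -mulmxA (dotp_mull C^T) !trmxK dotpDr.
    have := dotp_ge0 (C *m x t - C *m xi).
    have := dotp_ge0 (u t + B^T *m s).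
    rewrite !dotpDl !dotpDr !dotpNl !dotpNr.
    rewrite (dotpC s (B *m _)) (dotp_mull B).
    rewrite (dotpC (B^T *m s) (u t)) (dotpC (C *m x t) (C *m xi)).
    lra.
  exact: dphi.
rewrite F0 /phi subr0 subrr q0 x0 mulr0 add0r addr0.
(* As [q 0 = P *m xi], the terms in [x h] are [2 * dotp (P *m xi) (x h) - V (x h)], which is at most
   [V xi]. *)
by have := linear_lower_bound xi (x h); move: Fh; rewrite -!PV; lra.
Qed.

(** By [dual_bound], [2 * dotp (q h) xi - kappa * h] does not exceed its value at [h = 0] for small
    [h]; its derivative there is [<S xi, xi> - e]. *)
Lemma riccati_le0 xi : dotp (riccati A B C P *m xi) xi <= 0.
Proof.
apply/ler_addgt0Pr => e e0; rewrite add0r.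
have [q [q0 dq]] := affine_ode_solution A^T (C^T *m C *m xi) (P *m xi).
have dB : is_derive 0 (1 : R) (fun t => dotp (B^T *m q t) (B^T *m q t)) _ :=
  is_derive_dotp (vderive_mulmx B^T (dq 0)) (vderive_mulmx B^T (dq 0)).
have [r r0 Br] := is_derive_usc dB e0.
pose kappa := dotp (C *m xi) (C *m xi) + (dotp (B^T *m q 0) (B^T *m q 0) + e).
have dxi : vderive 0 (fun=> xi) (0 : 'cV[R]_n).
  by move=> i; rewrite mxE; exact: is_derive_cst.
have dqxi := is_derive_dotp (dq 0) dxi.
have df : is_derive 0 (1 : R) (fun t => 2 * dotp (q t) xi - kappa * t) _ :=
  is_deriveB (is_deriveZ 2 dqxi) (is_derive_linear kappa 0).
have := is_derive_le0 df r0 => H.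
have : 2 * (dotp (A^T *m q 0 + C^T *m C *m xi) xi + dotp (q 0) 0) - kappa <= 0.
  apply: H => h h0 hr; rewrite add0r.
  rewrite mulr0 subr0 lerBlDr q0; apply: dual_bound => // s s0 sh.
  rewrite lerD2l; apply: Br.
  by rewrite subr0 gtr0_norm// (lt_trans sh).
rewrite riccati_form /kappa dotp0r addr0 q0 dotpDl -!mulmxA.
by rewrite (dotp_mull A^T) (dotp_mull C^T) !trmxK; lra.
Qed.

Lemma riccati_eq0 : riccati A B C P = 0.
Proof.
set S := riccati A B C P.
have S0 xi : dotp (S *m xi) xi = 0.
  by apply/le_anti; rewrite riccati_le0 riccati_ge0.
have Ssym : S^T = S.
  rewrite /S /riccati !raddfD/= raddfN/= !trmx_mul !trmxK Psym.
  by rewrite (addrC (P *m A)) !mulmxA.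
have Sv xi : S *m xi = 0.
  (* By symmetry of [S], the form at [xi + S *m xi] reduces to twice the squared norm of
     [S *m xi]. *)
  apply: dotp_eq0; have := S0 (xi + S *m xi).
  rewrite mulmxDr !dotpDl !dotpDr !S0 (dotp_mull S (S *m xi)) Ssym.
  lra.
apply/matrixP => i j; have := Sv (delta_mx j 0).
by rewrite -colE => /matrixP /(_ i 0); rewrite !mxE.
Qed.

(** Both inequalities of dynamic programming give [F t = V xi - V (x t)] for [t > 0]. Equating the
    derivatives of the two sides, with [S = 0], leaves only the square in [completed_square], which
    must vanish. *)
Lemma optimal_feedback xi u x : optimal A B C xi u x ->
  {ae mu, forall t : R, 0 <= t -> u t = - (B^T *m P *m x t)}.
Proof.
move=> [ux opt]; have [[mu_ iu] tx] := ux.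
have cV : (cost C u x <= (V xi)%:E)%E.
  by rewrite -valueE//; apply: le_ereal_inf_tmp => _ [v [y [vy ->]]]; exact: opt.
have cfin : (cost C u x < +oo)%E by rewrite (le_lt_trans cV)// ltry.
have [F [FE F0 Fnd dF]] := ae_derivable_primitive
  (measurable_running_cost C mu_ tx) (running_cost_ge0 C u x) cfin.
have Fval t : 0 < t -> F t = V xi - dotp (P *m x t) (x t).
  move=> t0; rewrite PV.
  have : F t + V (x t) <= V xi.
    by rewrite -lee_fin EFinD -FE (le_trans _ cV)//; exact: (prefix_le_cost hfin t0 ux).
  have : V xi <= F t + V (x t).
    by apply: (fine_value_le_prefix hfin t0 tx mu_); rewrite FE.
  lra.
have [_ _ dx] := tx; move: dF dx (@ae_neq R 0).
apply: filterS3; first exact: (ae_filter_ringOfSetsType mu).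
move=> t dFt dxt tn0 t_ge0.
have t0 : 0 < t by rewrite lt_neqAle eq_sym tn0.
have dV := is_derive_quadratic Psym (dxt t0).
have dF2 : is_derive t (1 : R) F (0 - 2 * dotp (P *m x t) (A *m x t + B *m u t)).
  apply: near_eq_is_derive (is_deriveB (is_derive_cst (V xi) t 1) dV).
  near=> s; rewrite Fval//; near: s; exact: lt_nbhsr.
have : l u x t = 0 - 2 * dotp (P *m x t) (A *m x t + B *m u t).
  by have [_ <-] := dFt t0; have [_ <-] := dF2.
rewrite /running_cost !enorm_sqr => eq.
have := completed_square (x t) (u t).
rewrite eq riccati_eq0 mul0mx dotp0l addr0 sub0r addNr => /esym /dotp_eq0 /eqP.
by rewrite addr_eq0 => /eqP.
Unshelve. all: by end_near. Qed.

End riccati_equation.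

Unset Implicit Arguments.

Theorem theorem9p2 (R : realType) (n p m : nat)
    (A : 'M[R]_n) (B : 'M[R]_(n, p)) (C : 'M[R]_(m, n))
    (hfin : finite_cost_condition A B C) :
  exists P : 'M[R]_n,
    [/\ P^T = P,
        forall xi : 'cV[R]_n, (dotp (P *m xi) xi)%:E = value A B C xi,
        forall (xi : 'cV[R]_n) (u : R -> 'cV[R]_p) (x : R -> 'cV[R]_n),
          optimal A B C xi u x ->
          {ae lebesgue_measure, forall t : R, 0 <= t ->
            u t = - (B^T *m P *m x t)} &
        A^T *m P + P *m A - P *m B *m B^T *m P + C^T *m C = 0].
Proof.
have [P [Psym PV]] := fine_value_quadratic hfin.
exists P; split => //.
- by move=> xi; rewrite PV valueE.
- by move=> xi u x; exact: optimal_feedback.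
- exact: riccati_eq0.
Qed.
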